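(* Let $\alpha\ge 1$ be an integer, let $M>0$, and let $F(z)=\sum_{k=0}^{\alpha-1}\overline{z}^{k}A_k(z)$ be a poly-analytic function of order $\alpha$ on $U$, where each $A_k$ is analytic on $U$ with $A_k(0)=0$, $A_k'(0)=1$ and $|A_k(z)|\le M$ for all $z\in U$ and all $k=0,\dots,\alpha-1$. Then there is a constant $\rho_1$ with $0<\rho_1<1$ satisfying $$1-M\left(\frac{\rho_1(2-\rho_1)}{(1-\rho_1)^2}+\sum_{k=1}^{\alpha-1}\frac{\rho_1^{k}(1+k-\rho_1)}{(1-\rho_1)^2}\right)=0$$ such that $F$ is univalent in $|z|<\rho_1$, and $F(U_{\rho_1})$ contains the disk $U_{R_1}$, where $$R_1=\rho_1-\rho_1^{2}\,\frac{1-\rho_1^{\alpha-1}}{1-\rho_1}-M\sum_{k=0}^{\alpha-1}\frac{\rho_1^{k+2}}{1-\rho_1}.$$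
   Context: $U=\{z\in\mathbb{C}:|z|<1\}$ is the open unit disk and $U_\rho=\{z\in\mathbb{C}:|z|<\rho\}$. A continuous function $F$ on a domain is poly-analytic of order $\alpha$ if $\partial_{\overline z}^{\alpha}F=0$; such functions have the form $F(z)=\sum_{k=0}^{\alpha-1}\overline z^{k}A_k(z)$ with $A_k$ analytic. Univalent means injective. *)

(* Defs.v *)
From Stdlib Require Import Reals.
From Coquelicot Require Import Coquelicot.

Local Open Scope C_scope.

Definition disk (r : R) (z : C) : Prop := (Cmod z < r)%R.

(* [ex_derive] is over the field of scalars C here: complex differentiability.
   It is used on open sets only. *)
Definition analytic_on (D : C -> Prop) (f : C -> C) : Prop :=
  forall z : C, D z -> ex_derive (K := C_AbsRing) (V := C_NormedModule) f z.

(* F is real-differentiable at z with differential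
   dF = p dz + l d(conj z), so that l is the Wirtinger derivative
   (1/2) (dF/dx + i dF/dy) of F at z. *)
Definition is_dbar (F : C -> C) (z l : C) : Prop :=
  exists p : C,
    filterdiff (K := R_AbsRing) (U := C_R_NormedModule) (V := C_R_NormedModule)
      F (locally z) (fun h : C => p * h + l * Cconj h).

(* G j is the j-th iterated Wirtinger derivative of F on D; continuity of F
   on D is part of its differentiability, as the order is positive in use. *)
Definition polyanalytic_on (D : C -> Prop) (alpha : nat) (F : C -> C) : Prop :=
  exists G : nat -> C -> C,
    G 0%nat = F /\
    (forall (j : nat) (z : C), (j < alpha)%nat -> D z ->
       is_dbar (G j) z (G (S j) z)) /\
    (forall z : C, D z -> G alpha z = 0).

Definition univalent_on (D : C -> Prop) (F : C -> C) : Prop :=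
  forall z w : C, D z -> D w -> F z = F w -> z = w.

(* Main.v *)
(* With G(z) = F(z) - z, Cauchy's formula on circles of radius tending to 1
   shows that each A_k satisfies
     |A_k(z) - z| <= M r^2 / (1 - r)  and
     |(A_k(z) - z) - (A_k(w) - w)| <= M (1 / (1 - r)^2 - 1) |z - w|
   on |z|, |w| <= r, with no power series involved.  Summing up, G is Lipschitz
   on |z| <= r with a constant L(r) that is strictly increasing in r and equals
   1 at r = rho1; hence F is injective on |z| < rho1.  Moreover
   |G(z)| <= rho1 - R1 for |z| < rho1, so for |w| < R1 the map z |-> w - G(z)
   is a contraction of the closed disk of radius |w| + rho1 - R1 < rho1, and
   its fixed point solves F(z) = w.
   Complex differentiability is only assumed pointwise, so Cauchy's formula
   rests on Goursat's theorem for rectangles, transported to annuli by exp. *)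
Require Import Defs.
From Stdlib Require Import Reals Ranalysis5 Lra Lia ClassicalEpsilon.
From Coquelicot Require Import Coquelicot.

Local Open Scope R_scope.

(** * Integrals of complex-valued functions *)

(** All bounds on the [A k] come from one device: the Cauchy formulas at p and q and the formula for
    f'(0) = 1 are combined linearly into f(p) - f(q) - c, an integral of f against a single kernel.
    The choices c = 0, c = p and c = p - q give the different estimates, and the constants are read
    off from how that kernel factors. Since f is bounded only on the open disk, the kernel is
    estimated on |z| = r < 1 and r then tends to 1. Circle integrals are taken in the angle t. As dz
    = i z dt, Cauchy's kernel becomes z / (z - p), and Cauchy's formula becomes a mean value
    property of z (f(z) - f(p)) / (z - p). This quotient is known only to be continuous at p, so the
    mean value property has to allow one such point. Only the term k = 0 is compared with z. For k
    >= 1 the whole product conj(z)^k A_k(z) is estimated, which needs two more bounds: |A_k(z)| <= M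
    r / (1 - r) and the Lipschitz constant M / (1 - r)^2. *)

Definition Cint (f : R -> C) (a b : R) : C :=
  RInt (V := C_R_CompleteNormedModule) f a b.

Definition cint_ok (f : R -> C) (a b : R) : Prop :=
  ex_RInt (V := C_R_NormedModule) f a b.

Lemma C_pair_eta (z : C) : z = (Re z, Im z).
Proof. now destruct z. Qed.

Lemma Cint_correct (f : R -> C) (a b : R) :
  cint_ok f a b -> is_RInt (V := C_R_NormedModule) f a b (Cint f a b).
Proof. intros H. exact (RInt_correct (V := C_R_CompleteNormedModule) f a b H). Qed.

Lemma Cint_unique (f : R -> C) (a b : R) (l : C) :
  is_RInt (V := C_R_NormedModule) f a b l -> Cint f a b = l.
Proof. exact (is_RInt_unique (V := C_R_CompleteNormedModule) f a b l). Qed.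

Lemma cint_ok_continuous (f : R -> C) (a b : R) : a <= b ->
  (forall t, a <= t <= b -> continuous (U := C_UniformSpace) f t) -> cint_ok f a b.
Proof.
  intros Hab H. apply (ex_RInt_continuous (V := C_R_CompleteNormedModule)).
  rewrite Rmin_left, Rmax_right by lra. exact H.
Qed.

(** [C_R_NormedModule] has real scalars only, so a complex factor is handled through real and
    imaginary parts. *)
Lemma is_RInt_Cmult (f : R -> C) (a b : R) (c l : C) :
  is_RInt (V := C_R_NormedModule) f a b l ->
  is_RInt (V := C_R_NormedModule) (fun t => Cmult c (f t)) a b (Cmult c l).
Proof.
  intros H.
  assert (H1 := is_RInt_fct_extend_fst (U := R_NormedModule) (V := R_NormedModule) f a b l H).
  assert (H2 := is_RInt_fct_extend_snd (U := R_NormedModule) (V := R_NormedModule) f a b l H).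
  destruct c as [p q].
  apply (is_RInt_fct_extend_pair (U := R_NormedModule) (V := R_NormedModule)); simpl.
  - apply (is_RInt_minus (V := R_NormedModule));
      apply (is_RInt_scal (V := R_NormedModule)); assumption.
  - apply (is_RInt_plus (V := R_NormedModule));
      apply (is_RInt_scal (V := R_NormedModule)); assumption.
Qed.

Lemma Cint_Cmult (f : R -> C) (a b : R) (c : C) :
  cint_ok f a b -> Cint (fun t => Cmult c (f t)) a b = Cmult c (Cint f a b).
Proof. intros H. apply Cint_unique, is_RInt_Cmult, Cint_correct, H. Qed.

Lemma cint_ok_minus (f g : R -> C) (a b : R) :
  cint_ok f a b -> cint_ok g a b -> cint_ok (fun t => Cminus (f t) (g t)) a b.
Proof. exact (ex_RInt_minus (V := C_R_NormedModule) f g a b). Qed.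

Lemma Cint_minus (f g : R -> C) (a b : R) :
  cint_ok f a b -> cint_ok g a b ->
  Cint (fun t => Cminus (f t) (g t)) a b = Cminus (Cint f a b) (Cint g a b).
Proof. exact (RInt_minus (V := C_R_CompleteNormedModule) f g a b). Qed.

Lemma Cint_ext (f g : R -> C) (a b : R) : a <= b ->
  (forall t, a <= t <= b -> f t = g t) -> Cint f a b = Cint g a b.
Proof.
  intros Hab H. apply (RInt_ext (V := C_R_CompleteNormedModule)).
  rewrite Rmin_left, Rmax_right by lra. intros; apply H; lra.
Qed.

Lemma cint_ok_const (a b : R) (c : C) : cint_ok (fun _ => c) a b.
Proof. exact (ex_RInt_const (V := C_R_NormedModule) a b c). Qed.

Lemma Cint_const (a b : R) (c : C) : Cint (fun _ => c) a b = Cmult (RtoC (b - a)) c.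
Proof.
  unfold Cint. rewrite RInt_const. rewrite (C_pair_eta c).
  apply injective_projections; simpl; unfold scal; simpl; unfold mult; simpl; ring.
Qed.

Lemma Cint_Chasles (f : R -> C) (a b c : R) :
  cint_ok f a b -> cint_ok f b c -> Cint f a c = Cplus (Cint f a b) (Cint f b c).
Proof. intros H1 H2. symmetry. exact (RInt_Chasles (V := C_R_CompleteNormedModule) f a b c H1 H2). Qed.

Lemma Cint_bound (f : R -> C) (a b K : R) : a <= b -> cint_ok f a b ->
  (forall t, a <= t <= b -> Cmod (f t) <= K) -> Cmod (Cint f a b) <= (b - a) * K.
Proof.
  intros Hab Hf H. rewrite Cmod_norm.
  apply (norm_RInt_le_const (V := C_R_NormedModule) f a b); trivial.
  - intros t Ht. specialize (H t Ht). now rewrite Cmod_norm in H.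
  - now apply Cint_correct.
Qed.

(** * Continuity and complex derivatives in terms of [Cmod] *)

Lemma continuous_C_iff (U : UniformSpace) (f : U -> C) (x : U) :
  continuous (U := C_UniformSpace) f x <->
  (forall eps, 0 < eps -> locally x (fun y => Cmod (Cminus (f y) (f x)) < eps)).
Proof.
  split.
  - intros H eps He. 
    assert (H' := proj1 (filterlim_locally_ball_norm (K := R_AbsRing) (U := C_R_NormedModule) f (f x)) H (mkposreal eps He)).
    revert H'. apply filter_imp. intros y Hy. rewrite Cmod_norm. exact Hy.
  - intros H.
    apply (proj2 (filterlim_locally_ball_norm (K := R_AbsRing) (U := C_R_NormedModule) f (f x))).
    intros [eps He]. specialize (H eps He). revert H. apply filter_imp. intros y Hy.
    rewrite Cmod_norm in Hy. exact Hy.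
Qed.

(* [is_derive] over [C_AbsRing] uses the filter of this uniform space, which is not
   convertible to that of [C_UniformSpace]. *)
Lemma locally_C_AbsRing_iff (z : C) (P : C -> Prop) :
  locally (T := AbsRing_UniformSpace C_AbsRing) z P <->
  exists d, 0 < d /\ forall w, Cmod (Cminus w z) < d -> P w.
Proof.
  split.
  - intros [[d Hd] H]. exists d. split; trivial.
  - intros [d [Hd H]]. exists (mkposreal d Hd). exact H.
Qed.

Notation Cder f z := (ex_derive (K := C_AbsRing) (V := C_NormedModule) f z).

Lemma is_derive_C_iff (f : C -> C) (z l : C) :
  is_derive (K := C_AbsRing) (V := C_NormedModule) f z l <->
  forall eps, 0 < eps -> exists d, 0 < d /\ forall w, Cmod (Cminus w z) < d ->
    Cmod (Cminus (Cminus (f w) (f z)) (Cmult l (Cminus w z))) <= eps * Cmod (Cminus w z).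
Proof.
  split.
  - intros [_ H] eps He. 
    specialize (H z (fun P HP => HP) (mkposreal eps He)).
    apply locally_C_AbsRing_iff in H. destruct H as [d [Hd H]]. exists d; split; trivial.
    intros w Hw. specialize (H w Hw).
    rewrite (Cmult_comm l). exact H.
  - intros H. split.
    + apply is_linear_scal_l.
    + intros y Hy. 
      apply (is_filter_lim_locally_unique (V := AbsRing_NormedModule C_AbsRing)) in Hy.
      subst y.
      intros [eps He]. destruct (H eps He) as [d [Hd H']].
      apply locally_C_AbsRing_iff. exists d; split; trivial. intros w Hw. specialize (H' w Hw).
      rewrite (Cmult_comm l) in H'. exact H'.
Qed.

(** * Goursat's theorem for rectangles *)

(** If [P] fails on the whole rectangle, it fails on some quarter, and so on forever; the nested
    failing rectangles share a point, where the local hypothesis gives a contradiction. At depth n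
    the sides are [w / 2 ^ n] and [v / 2 ^ n], so a rectangle is recorded by its lower left
    corner. *)
Lemma nested_bisection (w v a c : R) (P : nat -> R -> R -> Prop) :
  0 <= w -> 0 <= v ->
  (forall n x y, a <= x -> x + w / 2 ^ n <= a + w -> c <= y -> y + v / 2 ^ n <= c + v ->
     P (S n) x y -> P (S n) (x + w / 2 ^ S n) y ->
     P (S n) x (y + v / 2 ^ S n) -> P (S n) (x + w / 2 ^ S n) (y + v / 2 ^ S n) ->
     P n x y) ->
  (forall x0 y0, a <= x0 <= a + w -> c <= y0 <= c + v ->
     exists n, forall x y, a <= x -> x + w / 2 ^ n <= a + w -> c <= y -> y + v / 2 ^ n <= c + v ->
       x <= x0 <= x + w / 2 ^ n -> y <= y0 <= y + v / 2 ^ n -> P n x y) ->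
  P 0%nat a c.
Proof.
  intros Hw Hv Hstep Hloc. apply NNPP. intros HN.
  pose (Q := fun n (p : R * R) =>
    (a <= fst p /\ fst p + w / 2 ^ n <= a + w) /\
    (c <= snd p /\ snd p + v / 2 ^ n <= c + v) /\ ~ P n (fst p) (snd p)).
  assert (Hhalf : forall u n, u / 2 ^ n = u / 2 ^ S n + u / 2 ^ S n).
  { intros u n. simpl. field. apply pow_nonzero; lra. }
  assert (Hpos : forall u n, 0 <= u -> 0 <= u / 2 ^ n).
  { intros u n Hu. apply Rdiv_le_0_compat; trivial. apply pow_lt; lra. }
  assert (Hnext : forall n p, Q n p -> exists p', Q (S n) p' /\
     (fst p <= fst p' /\ fst p' + w / 2 ^ S n <= fst p + w / 2 ^ n) /\
     (snd p <= snd p' /\ snd p' + v / 2 ^ S n <= snd p + v / 2 ^ n)).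
  { intros n [x y] [[H1 H2] [[H3 H4] H5]]; simpl in H1, H2, H3, H4, H5.
    assert (H6 := Hhalf w n). assert (H7 := Hhalf v n).
    assert (H8 := Hpos w (S n) Hw). assert (H9 := Hpos v (S n) Hv).
    assert (Hall : forall x' y',
       (x' = x \/ x' = x + w / 2 ^ S n) -> (y' = y \/ y' = y + v / 2 ^ S n) ->
       ~ P (S n) x' y' -> exists p', Q (S n) p' /\
     (x <= fst p' /\ fst p' + w / 2 ^ S n <= x + w / 2 ^ n) /\
     (y <= snd p' /\ snd p' + v / 2 ^ S n <= y + v / 2 ^ n)).
    { intros x' y' Hx Hy HP. exists (x', y'). unfold Q; cbn [fst snd].
      repeat split; try (destruct Hx; destruct Hy; lra). exact HP. }
    cbn [fst snd].
    apply NNPP; intros Hno. apply H5. apply Hstep; trivial;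
    apply NNPP; intros HP; apply Hno; refine (Hall _ _ _ _ HP); auto. }
  assert (Q0 : Q 0%nat (a, c)).
  { unfold Q; cbn [fst snd]; simpl. rewrite !Rdiv_1_r. repeat split; try lra. exact HN. }
  (* Dependent choice: the proof of [Q n p] travels with the corner, since [Hnext] needs it to
     supply the next one. *)
  pose (u := fix u n : {p | Q n p} := match n with
     | O => exist _ (a, c) Q0
     | S n => let (p', H) := constructive_indefinite_description _ (Hnext n (proj1_sig (u n)) (proj2_sig (u n)))
              in exist _ p' (proj1 H) end).
  pose (x := fun n => fst (proj1_sig (u n))). pose (y := fun n => snd (proj1_sig (u n))).
  assert (Hu : forall n, (x n <= x (S n) /\ x (S n) + w / 2 ^ S n <= x n + w / 2 ^ n) /\
     (y n <= y (S n) /\ y (S n) + v / 2 ^ S n <= y n + v / 2 ^ n)).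
  { intros n. unfold x, y. cbn [u].
    destruct (constructive_indefinite_description _ _) as [p' [H1 H2]]. exact H2. }
  (* The common point of nested intervals is the supremum of the left ends, as every right end is an
     upper bound of them. Intervals of length zero are allowed. *)
  assert (Hnest : forall (s : nat -> R) (l : R), 0 <= l ->
     (forall n, s n <= s (S n) /\ s (S n) + l / 2 ^ S n <= s n + l / 2 ^ n) ->
     exists s0, forall n, s n <= s0 <= s n + l / 2 ^ n).
  { intros s l Hl Hs.
    assert (Hmon : forall n k, s n <= s (n + k)%nat /\ s (n + k)%nat + l / 2 ^ (n + k) <= s n + l / 2 ^ n).
    { intros n k. induction k as [|k IH].
      - rewrite Nat.add_0_r. lra.
      - rewrite Nat.add_succ_r. specialize (Hs (n + k)%nat). lra. }
    assert (Hub : forall n, is_upper_bound (fun r => exists k, r = s k) (s n + l / 2 ^ n)).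
    { intros n r [k ->]. destruct (Nat.le_ge_cases n k) as [H|H].
      - destruct (Hmon n (k - n)%nat) as [_ H']. replace (n + (k - n))%nat with k in H' by lia.
        specialize (Hpos l k Hl). lra.
      - destruct (Hmon k (n - k)%nat) as [H' _]. replace (k + (n - k))%nat with n in H' by lia.
        specialize (Hpos l n Hl). lra. }
    destruct (completeness (fun r => exists k, r = s k)) as [s0 [H1 H2]].
    - now exists (s 0%nat + l / 2 ^ 0).
    - now exists (s 0%nat), 0%nat.
    - exists s0. intros n. split.
      + apply H1. now exists n.
      + now apply H2. }
  destruct (Hnest x w Hw (fun n => proj1 (Hu n))) as [x0 Hx0].
  destruct (Hnest y v Hv (fun n => proj2 (Hu n))) as [y0 Hy0].
  assert (HQ : forall n, Q n (x n, y n)).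
  { intros n. assert (H := proj2_sig (u n)). unfold x, y.
    destruct (proj1_sig (u n)). exact H. }
  assert (Hx := Hx0 0%nat). assert (Hy := Hy0 0%nat).
  assert (Ex : x 0%nat = a) by reflexivity. assert (Ey : y 0%nat = c) by reflexivity.
  rewrite Ex in Hx; rewrite Ey in Hy. simpl pow in Hx, Hy. rewrite Rdiv_1_r in Hx, Hy.
  destruct (Hloc x0 y0 Hx Hy) as [n Hn].
  destruct (HQ n) as [[H1 H2] [[H3 H4] H5]]. apply H5. apply Hn; trivial.
  - exact (Hx0 n).
  - exact (Hy0 n).
Qed.

(** The counterclockwise integral of h dz along the boundary of [a, b] x [c, d]. Opposite sides
    share an integrand, so that a periodic h or an affine h can be treated pointwise. *)
Definition rect_int (h : C -> C) (a b c d : R) : C :=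
  Cplus (Cint (fun x => Cminus (h (x, c)) (h (x, d))) a b)
    (Cmult Ci (Cint (fun y => Cminus (h (b, y)) (h (a, y))) c d)).

Lemma continuous_hline (h : C -> C) (x y : R) :
  Cder h (x, y) -> continuous (U := C_UniformSpace) (fun t => h (t, y)) x.
Proof.
  intros H. apply ex_derive_continuous in H.
  apply continuous_C_iff. intros eps He.
  assert (H' := proj1 (continuous_C_iff (AbsRing_UniformSpace C_AbsRing) h (x, y)) H eps He).
  apply locally_C_AbsRing_iff in H'. destruct H' as [d [Hd H']].
  exists (mkposreal d Hd). intros t Ht. apply H'.
  replace (Cminus (t, y) (x, y)) with (RtoC (t - x)).
  - rewrite Cmod_R. exact Ht.
  - apply injective_projections; simpl; ring.
Qed.

Lemma continuous_vline (h : C -> C) (x y : R) :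
  Cder h (x, y) -> continuous (U := C_UniformSpace) (fun t => h (x, t)) y.
Proof.
  intros H. apply ex_derive_continuous in H.
  apply continuous_C_iff. intros eps He.
  assert (H' := proj1 (continuous_C_iff (AbsRing_UniformSpace C_AbsRing) h (x, y)) H eps He).
  apply locally_C_AbsRing_iff in H'. destruct H' as [d [Hd H']].
  exists (mkposreal d Hd). intros t Ht. apply H'.
  replace (Cminus (x, t) (x, y)) with (Cmult Ci (RtoC (t - y))).
  - rewrite Cmod_mult, Cmod_R, Cmod_Ci, Rmult_1_l. exact Ht.
  - apply injective_projections; simpl; ring.
Qed.

Lemma rect_int_edges (h : C -> C) (a b c d : R) :
  cint_ok (fun x => h (x, c)) a b -> cint_ok (fun x => h (x, d)) a b ->
  cint_ok (fun y => h (a, y)) c d -> cint_ok (fun y => h (b, y)) c d ->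
  rect_int h a b c d =
  Cplus (Cminus (Cint (fun x => h (x, c)) a b) (Cint (fun x => h (x, d)) a b))
    (Cmult Ci (Cminus (Cint (fun y => h (b, y)) c d) (Cint (fun y => h (a, y)) c d))).
Proof.
  intros H1 H2 H3 H4. unfold rect_int.
  now rewrite (Cint_minus _ _ _ _ H1 H2), (Cint_minus _ _ _ _ H4 H3).
Qed.

(** The inner segments are run through twice, in opposite directions. *)
Lemma rect_int_split (h : C -> C) (a m b c n d : R) :
  a <= m <= b -> c <= n <= d ->
  (forall x y, a <= x <= b -> c <= y <= d -> Cder h (x, y)) ->
  rect_int h a b c d =
  Cplus (Cplus (rect_int h a m c n) (rect_int h m b c n))
        (Cplus (rect_int h a m n d) (rect_int h m b n d)).
Proof.
  intros Hm Hn Hh.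
  assert (Hhor : forall p q y, a <= p -> p <= q -> q <= b -> c <= y <= d ->
            cint_ok (fun x => h (x, y)) p q).
  { intros p q y ? ? ? ?. apply cint_ok_continuous; trivial.
    intros t Ht. apply continuous_hline, Hh; lra. }
  assert (Hver : forall p q x, c <= p -> p <= q -> q <= d -> a <= x <= b ->
            cint_ok (fun y => h (x, y)) p q).
  { intros p q x ? ? ? ?. apply cint_ok_continuous; trivial.
    intros t Ht. apply continuous_vline, Hh; lra. }
  rewrite (rect_int_edges h a b c d), (rect_int_edges h a m c n), (rect_int_edges h m b c n),
    (rect_int_edges h a m n d), (rect_int_edges h m b n d)
    by (match goal with
        | |- cint_ok (fun x => h (x, _)) _ _ => apply Hhor; lra
        | |- cint_ok (fun y => h (_, y)) _ _ => apply Hver; lra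
        end).
  rewrite (Cint_Chasles (fun x => h (x, c)) a m b), (Cint_Chasles (fun x => h (x, d)) a m b)
    by (apply Hhor; lra).
  rewrite (Cint_Chasles (fun y => h (a, y)) c n d), (Cint_Chasles (fun y => h (b, y)) c n d)
    by (apply Hver; lra).
  ring.
Qed.

Lemma Cmod_le_abs_sum (x y : R) : Cmod (x, y) <= Rabs x + Rabs y.
Proof.
  replace (x, y) with (Cplus (RtoC x) (Cmult Ci (RtoC y)))
    by (apply injective_projections; simpl; ring).
  eapply Rle_trans; [apply Cmod_triangle|].
  rewrite Cmod_mult, Cmod_Ci, !Cmod_R. lra.
Qed.

(* The integral of the affine part of [h] at a point of the rectangle vanishes,
   so only the remainder contributes. *)
Lemma rect_int_local (h : C -> C) (a b c d : R) (z0 p q : C) (e : R) :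
  a <= b -> c <= d ->
  (forall x y, a <= x <= b -> c <= y <= d -> Cder h (x, y)) ->
  (forall x y, a <= x <= b -> c <= y <= d ->
     Cmod (Cminus (Cminus (h (x, y)) p) (Cmult q (Cminus (x, y) z0))) <= e) ->
  Cmod (rect_int h a b c d) <= 2 * e * ((b - a) + (d - c)).
Proof.
  intros Hab Hcd Hh He.
  pose (r := fun z => Cminus (Cminus (h z) p) (Cmult q (Cminus z z0))).
  assert (H1 : cint_ok (fun x => Cminus (h (x, c)) (h (x, d))) a b).
  { apply cint_ok_minus; apply cint_ok_continuous; trivial; intros;
      apply continuous_hline, Hh; lra. }
  assert (H2 : cint_ok (fun y => Cminus (h (b, y)) (h (a, y))) c d).
  { apply cint_ok_minus; apply cint_ok_continuous; trivial; intros;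
      apply continuous_vline, Hh; lra. }
  (* Between opposite sides the affine part changes by the constants q i (c - d) and q (b - a).
     Their contributions q i (c - d) (b - a) and i q (b - a) (d - c) cancel. *)
  assert (E : rect_int h a b c d =
    Cplus (Cint (fun x => Cminus (Cminus (h (x, c)) (h (x, d))) (Cmult q (Cmult Ci (RtoC (c - d))))) a b)
    (Cmult Ci (Cint (fun y => Cminus (Cminus (h (b, y)) (h (a, y))) (Cmult q (RtoC (b - a)))) c d))).
  { rewrite (Cint_minus _ _ a b H1 (cint_ok_const a b _)),
      (Cint_minus _ _ c d H2 (cint_ok_const c d _)).
    rewrite !Cint_const. unfold rect_int. 
    rewrite !RtoC_minus. ring. }
  rewrite E. eapply Rle_trans; [apply Cmod_triangle|].
  rewrite Cmod_mult, Cmod_Ci, Rmult_1_l.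
  assert (B : forall z w, Cmod (r z) <= e -> Cmod (r w) <= e -> Cmod (Cminus (r z) (r w)) <= 2 * e).
  { intros z w Hz Hw. unfold Cminus at 1. eapply Rle_trans; [apply Cmod_triangle|].
    rewrite Cmod_opp. lra. }
  assert (I1 : Cmod (Cint (fun x => Cminus (Cminus (h (x, c)) (h (x, d))) (Cmult q (Cmult Ci (RtoC (c - d))))) a b) <= (b - a) * (2 * e)).
  { apply Cint_bound; trivial.
    - apply cint_ok_minus; trivial. apply cint_ok_const.
    - intros t Ht. eapply Rle_trans; [|apply (B (t, c) (t, d)); apply He; lra].
      apply Req_le, f_equal. unfold r.
      replace (Cmult Ci (RtoC (c - d))) with (Cminus (t, c) (t, d))
        by (apply injective_projections; simpl; ring). ring. }
  assert (I2 : Cmod (Cint (fun y => Cminus (Cminus (h (b, y)) (h (a, y))) (Cmult q (RtoC (b - a)))) c d) <= (d - c) * (2 * e)).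
  { apply Cint_bound; trivial.
    - apply cint_ok_minus; trivial. apply cint_ok_const.
    - intros t Ht. eapply Rle_trans; [|apply (B (b, t) (a, t)); apply He; lra].
      apply Req_le, f_equal. unfold r.
      replace (RtoC (b - a)) with (Cminus (b, t) (a, t))
        by (apply injective_projections; simpl; ring). ring. }
  lra.
Qed.

(** The bisected property is |integral| <= eps / 4^n: four quarters add up to the bound for the
    whole, and near a point of differentiability both the remainder and the perimeter are of order
    2^-n. *)
Theorem goursat (h : C -> C) (a b c d : R) : a <= b -> c <= d ->
  (forall x y, a <= x <= b -> c <= y <= d -> Cder h (x, y)) ->
  rect_int h a b c d = RtoC 0.
Proof.
  intros Hab Hcd Hh. apply Cmod_eq_0. apply Rle_antisym; [|apply Cmod_ge_0].
  apply le_epsilon. intros eps Heps. rewrite Rplus_0_l.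
  pose (w := b - a). pose (v := d - c).
  replace b with (a + w) by (unfold w; ring). replace d with (c + v) by (unfold v; ring).
  assert (Hw : 0 <= w) by (unfold w; lra). assert (Hv : 0 <= v) by (unfold v; lra).
  pose (P := fun n x y => Cmod (rect_int h x (x + w / 2 ^ n) y (y + v / 2 ^ n)) <= eps / 4 ^ n).
  assert (H0 : P 0%nat a c).
  2: { unfold P in H0. simpl pow in H0. rewrite !Rdiv_1_r in H0. exact H0. }
  assert (Hpos : forall u n, 0 <= u -> 0 <= u / 2 ^ n).
  { intros u n Hu. apply Rdiv_le_0_compat; trivial. apply pow_lt; lra. }
  apply (nested_bisection w v); trivial.
  - intros n x y H1 H2 H3 H4 P1 P2 P3 P4. unfold P in *.
    assert (Hw' := Hpos w (S n) Hw). assert (Hv' := Hpos v (S n) Hv).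
    assert (Ew : x + w / 2 ^ n = x + w / 2 ^ S n + w / 2 ^ S n).
    { simpl. field. apply pow_nonzero; lra. }
    assert (Ev : y + v / 2 ^ n = y + v / 2 ^ S n + v / 2 ^ S n).
    { simpl. field. apply pow_nonzero; lra. }
    rewrite Ew, Ev in *.
    rewrite (rect_int_split h x (x + w / 2 ^ S n) _ y (y + v / 2 ^ S n)).
    + replace (eps / 4 ^ n) with (eps / 4 ^ S n + eps / 4 ^ S n + (eps / 4 ^ S n + eps / 4 ^ S n)).
      2:{ simpl. field. apply pow_nonzero; lra. }
      repeat (eapply Rle_trans; [apply Cmod_triangle|]; apply Rplus_le_compat); trivial.
    + lra.
    + lra.
    + intros; apply Hh; unfold w, v in *; lra.
  - intros x0 y0 Hx0 Hy0.
    destruct (Hh x0 y0) as [q Hq]; [unfold w in *; lra | unfold v in *; lra|].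
    (* [K / 2 ^ n] bounds both the distance to (x0, y0) and the sum of the two sides; the 1 keeps
       [K] positive for degenerate rectangles. [e] is chosen so that 2 (e K / 2^n) (K / 2^n) = eps /
       4^n. *)
    pose (K := w + v + 1). assert (HK : 0 < K) by (unfold K; lra).
    pose (e := eps / (2 * K * K)).
    assert (He : 0 < e) by (apply Rdiv_lt_0_compat; [lra | nra]).
    destruct (proj1 (is_derive_C_iff _ _ _) Hq e He) as [dl [Hdl Hd]].
    destruct (pow_lt_1_zero (/ 2)) with (y := dl / K) as [n Hn].
    { rewrite Rabs_pos_eq; lra. }
    { apply Rdiv_lt_0_compat; lra. }
    exists n. intros x y H1 H2 H3 H4 H5 H6. unfold P.
    specialize (Hn n (le_n n)).
    assert (Hp : 0 < / 2 ^ n) by (apply Rinv_0_lt_compat, pow_lt; lra).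
    assert (E2 : (/ 2) ^ n = / 2 ^ n) by (rewrite pow_inv; reflexivity).
    rewrite E2, Rabs_pos_eq in Hn by lra.
    assert (HKn : K * / 2 ^ n < dl).
    { apply (Rmult_lt_compat_l K) in Hn; trivial.
      replace (K * (dl / K)) with dl in Hn by (field; lra). exact Hn. }
    unfold Rdiv in *.
    assert (Hloc : forall s t, x <= s <= x + w * / 2 ^ n -> y <= t <= y + v * / 2 ^ n ->
      Cmod (Cminus (s, t) (x0, y0)) <= K * / 2 ^ n).
    { intros s t Hs Ht. eapply Rle_trans; [apply Cmod_le_abs_sum|]. simpl.
      assert (Rabs (s + - x0) <= w * / 2 ^ n) by (apply Rabs_le; lra).
      assert (Rabs (t + - y0) <= v * / 2 ^ n) by (apply Rabs_le; lra).
      unfold K. nra. }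
    eapply Rle_trans.
    + apply (rect_int_local h x (x + w * / 2 ^ n) y (y + v * / 2 ^ n) (x0, y0) (h (x0, y0)) q (e * (K * / 2 ^ n))).
      * assert (H := Hpos w n Hw). unfold Rdiv in H; lra.
      * assert (H := Hpos v n Hv). unfold Rdiv in H; lra.
      * intros; apply Hh; unfold w, v in *; lra.
      * intros s t Hs Ht. assert (H := Hloc s t Hs Ht).
        eapply Rle_trans; [apply Hd; lra|]. apply Rmult_le_compat_l; lra.
    + assert (E4 : / 4 ^ n = / 2 ^ n * / 2 ^ n).
      { replace 4 with (2 * 2) by ring. rewrite Rpow_mult_distr, Rinv_mult. reflexivity. }
      rewrite E4. set (T := / 2 ^ n) in *.
      replace eps with (2 * e * K * K) by (unfold e; field; lra).
      assert (0 <= e * K * T * T) by (clearbody e K T; repeat apply Rmult_le_pos; lra).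
      replace (x + w * T - x + (y + v * T - y)) with (K * T - T) by (unfold K; ring).
      nra.
Qed.

(** * Circle integrals *)

(** Phrased with [Cmod] so as not to depend on which uniform structure C carries. *)
Definition Ccont (f : C -> C) (z : C) : Prop :=
  forall eps, 0 < eps -> exists d, 0 < d /\ forall w, Cmod (Cminus w z) < d ->
    Cmod (Cminus (f w) (f z)) < eps.

Lemma Cder_Ccont (f : C -> C) (z : C) : Cder f z -> Ccont f z.
Proof.
  intros H eps He. apply ex_derive_continuous in H.
  apply locally_C_AbsRing_iff.
  exact (proj1 (continuous_C_iff (AbsRing_UniformSpace C_AbsRing) f z) H eps He).
Qed.

(** The rules for the identity, products and the inner function of a composition are stated for
    [AbsRing_NormedModule C_AbsRing], whereas [Cder] uses [C_NormedModule]; this is the bridge. *)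
Lemma is_derive_C_AbsRing_iff (f : C -> C) (z l : C) :
  is_derive (K := C_AbsRing) (V := AbsRing_NormedModule C_AbsRing) f z l <->
  is_derive (K := C_AbsRing) (V := C_NormedModule) f z l.
Proof.
  split; intros [_ H]; split; try apply is_linear_scal_l; exact H.
Qed.

Lemma Cder_AbsRing_iff (f : C -> C) (z : C) :
  ex_derive (K := C_AbsRing) (V := AbsRing_NormedModule C_AbsRing) f z <-> Cder f z.
Proof. split; intros [l H]; exists l; now apply is_derive_C_AbsRing_iff. Qed.

Lemma Cder_id (z : C) : Cder (fun w => w) z.
Proof. apply Cder_AbsRing_iff. exact (ex_derive_id (K := C_AbsRing) z). Qed.

Lemma Cder_const (c z : C) : Cder (fun _ => c) z.
Proof. apply (ex_derive_const (K := C_AbsRing) (V := C_NormedModule)). Qed.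

Lemma Cder_minus (f g : C -> C) (z : C) :
  Cder f z -> Cder g z -> Cder (fun w => Cminus (f w) (g w)) z.
Proof. exact (ex_derive_minus (K := C_AbsRing) (V := C_NormedModule) f g z). Qed.

Lemma Cder_mult (f g : C -> C) (z : C) :
  Cder f z -> Cder g z -> Cder (fun w => Cmult (f w) (g w)) z.
Proof.
  intros [l Hl] [m Hm]. apply Cder_AbsRing_iff. eexists.
  apply (is_derive_mult (K := C_AbsRing) f g z l m); [now apply is_derive_C_AbsRing_iff ..|].
  exact Cmult_comm.
Qed.

Lemma Cder_comp (f g : C -> C) (z : C) :
  Cder f (g z) -> Cder g z -> Cder (fun w => f (g w)) z.
Proof. 
  intros Hf Hg. apply (ex_derive_comp (K := C_AbsRing) (V := C_NormedModule) f g z Hf).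
  now apply Cder_AbsRing_iff.
 Qed.

Lemma Cmod_minus_sym (z w : C) : Cmod (Cminus z w) = Cmod (Cminus w z).
Proof. rewrite <- (Cmod_opp (Cminus w z)). f_equal. ring. Qed.

Lemma Cmod_triangle_sub (z w : C) : Cmod (Cminus z w) <= Cmod z + Cmod w.
Proof. unfold Cminus. rewrite <- (Cmod_opp w). apply Cmod_triangle. Qed.

Lemma Cmod_sub_ge (z w : C) : Cmod z - Cmod w <= Cmod (Cminus z w).
Proof.
  assert (H := Cmod_triangle (Cminus z w) w).
  replace (Cplus (Cminus z w) w) with z in H by ring. lra.
Qed.

Lemma Cder_inv (z : C) : z <> RtoC 0 -> Cder Cinv z.
Proof.
  intros Hz. exists (Copp (Cinv (Cmult z z))). apply is_derive_C_iff. intros eps He.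
  assert (Hp := Cmod_gt_0 z). apply Hp in Hz as Hm. clear Hp.
  set (m := Cmod z) in *.
  (* The remainder is (w - z)^2 / (w z^2). The first bound gives |w| > m / 2, hence |w z^2| > m^3 /
     2; the second then makes |w - z| / |w z^2| at most eps. *)
  exists (Rmin (m / 2) (eps * m ^ 3 / 2)). split.
  { apply Rmin_glb_lt; [lra|]. apply Rdiv_lt_0_compat; [|lra].
    apply Rmult_lt_0_compat; trivial. now apply pow_lt. }
  intros w Hw.
  assert (H1 := Rmin_l (m / 2) (eps * m ^ 3 / 2)).
  assert (H2 := Rmin_r (m / 2) (eps * m ^ 3 / 2)).
  assert (H3 := Cmod_sub_ge z w). rewrite Cmod_minus_sym in H3. fold m in H3.
  assert (Hw0 : w <> RtoC 0). { apply Cmod_gt_0. lra. }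
  replace (Cminus (Cminus (Cinv w) (Cinv z)) (Cmult (Copp (Cinv (Cmult z z))) (Cminus w z)))
    with (Cmult (Cminus w z) (Cdiv (Cminus w z) (Cmult w (Cmult z z)))) by (field; auto).
  rewrite Cmod_mult, Cmod_div, !Cmod_mult.
  2: { repeat apply Cmult_neq_0; trivial. }
  rewrite Rmult_comm. apply Rmult_le_compat_r; [apply Cmod_ge_0|].
  fold m. assert (0 < Cmod w) by lra.
  apply Rle_div_l; [repeat apply Rmult_lt_0_compat; lra|].
  assert (eps * m ^ 3 / 2 <= eps * (Cmod w * (m * m))); [|lra].
  assert (H5 : 0 < eps * (m * m)) by (apply Rmult_lt_0_compat; [lra | nra]).
  replace (eps * m ^ 3 / 2) with (eps * (m * m) * (m / 2)) by field.
  replace (eps * (Cmod w * (m * m))) with (eps * (m * m) * Cmod w) by ring.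
  apply Rmult_le_compat_l; lra.
Qed.

Lemma Cder_div (f g : C -> C) (z : C) : Cder f z -> Cder g z -> g z <> RtoC 0 ->
  Cder (fun w => Cdiv (f w) (g w)) z.
Proof.
  intros Hf Hg H. apply Cder_mult; trivial. apply (Cder_comp Cinv); trivial.
  now apply Cder_inv.
Qed.

(** * Polar coordinates and the complex exponential *)

Definition circ (r t : R) : C := (r * cos t, r * sin t).

Lemma Cmod_circ (r t : R) : 0 <= r -> Cmod (circ r t) = r.
Proof.
  intros Hr. unfold Cmod, circ; simpl.
  replace (r * cos t * (r * cos t * 1) + r * sin t * (r * sin t * 1))
    with (r ^ 2 * (Rsqr (sin t) + Rsqr (cos t))) by (unfold Rsqr; ring).
  rewrite sin2_cos2, Rmult_1_r. now apply sqrt_pow2.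
Qed.

Definition cexp (z : C) : C := circ (exp (fst z)) (snd z).

Lemma cexp_plus (z w : C) : cexp (Cplus z w) = Cmult (cexp z) (cexp w).
Proof.
  unfold cexp, circ. simpl. rewrite exp_plus, cos_plus, sin_plus.
  apply injective_projections; simpl; ring.
Qed.

Lemma derive_0_bound (f : R -> R) (l eps : R) : is_derive f 0 l -> 0 < eps ->
  exists d, 0 < d /\ forall t, Rabs t < d -> Rabs (f t - f 0 - l * t) <= eps * Rabs t.
Proof.
  intros [_ H] He. specialize (H 0 (fun P HP => HP) (mkposreal eps He)).
  destruct H as [[d Hd] H]. exists d; split; trivial. intros t Ht.
  specialize (H t). 
  assert (Hb : ball (M := R_UniformSpace) 0 d t).
  { unfold ball; simpl; unfold AbsRing_ball, abs, minus, plus, opp; simpl.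
    now rewrite Ropp_0, Rplus_0_r. }
  specialize (H Hb). unfold norm, minus, plus, opp, scal in H; simpl in H.
  unfold abs, mult in H; simpl in H. rewrite Ropp_0, Rplus_0_r in H.
  replace (f t - f 0 - l * t) with (f t + - f 0 + - (t * l)) by ring. exact H.
Qed.

Lemma Rabs_re_le_Cmod (z : C) : Rabs (fst z) <= Cmod z.
Proof. eapply Rle_trans; [apply Rmax_l|apply Rmax_Cmod]. Qed.

Lemma Rabs_im_le_Cmod (z : C) : Rabs (snd z) <= Cmod z.
Proof. eapply Rle_trans; [apply Rmax_r|apply Rmax_Cmod]. Qed.

Lemma cexp_0_bound (eps : R) : 0 < eps -> exists d, 0 < d /\ forall w, Cmod w < d ->
  Cmod (Cminus (Cminus (cexp w) (RtoC 1)) w) <= eps * Cmod w.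
Proof.
  (* With u, v, x the remainders of exp, cos and sin at 0, the real part of the error costs 4 e |w|
     and the imaginary part 5 e |w|, hence the 9. Taking |w| < e turns the quadratic terms into
     multiples of e |w|. *)
  intros He0. set (e := Rmin 1 (eps / 9)).
  assert (He : 0 < e) by (apply Rmin_glb_lt; lra).
  assert (He1 : e <= 1) by apply Rmin_l. assert (He2 : e <= eps / 9) by apply Rmin_r.
  clearbody e.
  destruct (derive_0_bound exp 1 e) as [d1 [Hd1 H1]]; trivial.
  { auto_derive; [trivial | rewrite exp_0; ring]. }
  destruct (derive_0_bound cos 0 e) as [d2 [Hd2 H2]]; trivial.
  { auto_derive; [trivial | rewrite sin_0; ring]. }
  destruct (derive_0_bound sin 1 e) as [d3 [Hd3 H3]]; trivial.
  { auto_derive; [trivial | rewrite cos_0; ring]. }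
  exists (Rmin e (Rmin d1 (Rmin d2 d3))). split.
  { repeat apply Rmin_glb_lt; trivial. }
  intros w Hw.
  assert (A1 := Rmin_l e (Rmin d1 (Rmin d2 d3))). assert (A2 := Rmin_r e (Rmin d1 (Rmin d2 d3))).
  assert (A3 := Rmin_l d1 (Rmin d2 d3)). assert (A4 := Rmin_r d1 (Rmin d2 d3)).
  assert (A5 := Rmin_l d2 d3). assert (A6 := Rmin_r d2 d3).
  assert (B1 := Rabs_re_le_Cmod w). assert (B2 := Rabs_im_le_Cmod w).
  destruct w as [s t]; simpl in B1, B2.
  specialize (H1 s ltac:(lra)). specialize (H2 t ltac:(lra)). specialize (H3 t ltac:(lra)).
  rewrite exp_0 in H1. rewrite cos_0 in H2. rewrite sin_0 in H3.
  set (u := exp s - 1 - 1 * s) in *. set (v := cos t - 1 - 0 * t) in *.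
  set (x := sin t - 0 - 1 * t) in *. set (m := Cmod (s, t)) in *.
  assert (Hm : 0 <= m) by apply Cmod_ge_0.
  replace (Cminus (Cminus (cexp (s, t)) (RtoC 1)) (s, t))
    with (u + (s + u) * v + v, x + (s + u) * (t + x))
    by (apply injective_projections; unfold u, v, x; simpl; ring).
  eapply Rle_trans; [apply Cmod_le_abs_sum|].
  assert (Hem : 0 <= e * m) by nra.
  assert (Hu : Rabs u <= e * m) by nra.
  assert (Hv : Rabs v <= e * m) by nra.
  assert (Hx : Rabs x <= e * m) by nra.
  assert (Hsu : Rabs (s + u) <= 2 * m) by (eapply Rle_trans; [apply Rabs_triang|]; nra).
  assert (Htx : Rabs (t + x) <= 2 * m) by (eapply Rle_trans; [apply Rabs_triang|]; nra).
  assert (Hm1 : m <= e) by lra.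
  assert (P1 : Rabs ((s + u) * v) <= 2 * (e * m)).
  { rewrite Rabs_mult. apply Rle_trans with (2 * m * (e * m)).
    - apply Rmult_le_compat; trivial; apply Rabs_pos.
    - nra. }
  assert (P2 : Rabs ((s + u) * (t + x)) <= 4 * (e * m)).
  { rewrite Rabs_mult. apply Rle_trans with (2 * m * (2 * m)).
    - apply Rmult_le_compat; trivial; apply Rabs_pos.
    - nra. }
  assert (T1 := Rabs_triang (u + (s + u) * v) v).
  assert (T2 := Rabs_triang u ((s + u) * v)).
  assert (T3 := Rabs_triang x ((s + u) * (t + x))).
  assert (9 * (e * m) <= eps * m) by nra.
  lra.
Qed.

(** By [cexp_plus], the increment at z is [cexp z] times the increment at 0. *)
Lemma Cder_cexp (z : C) : Cder cexp z.
Proof.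
  exists (cexp z). apply is_derive_C_iff. intros eps He.
  assert (Hz : 0 < Cmod (cexp z)).
  { unfold cexp. rewrite Cmod_circ; [apply exp_pos | apply Rlt_le, exp_pos]. }
  destruct (cexp_0_bound (eps / Cmod (cexp z))) as [d [Hd H]].
  { now apply Rdiv_lt_0_compat. }
  exists d. split; trivial. intros w Hw. specialize (H _ Hw).
  replace (Cminus (Cminus (cexp w) (cexp z)) (Cmult (cexp z) (Cminus w z)))
    with (Cmult (cexp z) (Cminus (Cminus (cexp (Cminus w z)) (RtoC 1)) (Cminus w z))).
  - rewrite Cmod_mult. apply (Rmult_le_compat_l (Cmod (cexp z))) in H; [|lra].
    replace (Cmod (cexp z) * (eps / Cmod (cexp z) * Cmod (Cminus w z)))
      with (eps * Cmod (Cminus w z)) in H by (field; lra). exact H.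
  - replace w with (Cplus z (Cminus w z)) at 3 by ring. rewrite cexp_plus. ring.
Qed.

(** 2 pi times the mean of g, with respect to dt and not dz. It therefore makes sense at r = 0,
    where it is 2 pi g(0), and the mean value property says that it does not depend on r. *)
Definition circle_int (g : C -> C) (r : R) : C :=
  Cint (fun t => g (circ r t)) 0 (2 * PI).

Lemma two_PI_pos : 0 < 2 * PI.
Proof. assert (H := PI_RGT_0). lra. Qed.

Lemma continuous_circ (g : C -> C) (r t : R) : Ccont g (circ r t) ->
  forall eps, 0 < eps -> exists d, 0 < d /\ forall r' t', Rabs (r' - r) < d -> Rabs (t' - t) < d ->
    Cmod (Cminus (g (circ r' t')) (g (circ r t))) < eps.
Proof.
  intros H eps He. destruct (H eps He) as [d [Hd H']].
  assert (Hk : forall k : R -> R, continuity_pt k t -> forall e, 0 < e -> exists d, 0 < d /\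
    forall t', Rabs (t' - t) < d -> Rabs (k t' - k t) < e).
  { intros k Hk e He'. destruct (proj1 (continuity_pt_locally k t) Hk (mkposreal e He')) as [[d' Hd'] H''].
    exists d'. split; trivial. }
  (* Changing the radius moves the point by at most 2 e, changing the angle by at most 2 |r| e; the
     sum is below d. *)
  set (e := d / (2 * (Rabs r + 2))).
  assert (Hr := Rabs_pos r).
  assert (He' : 0 < e) by (apply Rdiv_lt_0_compat; lra).
  destruct (Hk cos (continuity_cos t) e He') as [d1 [Hd1 H1]].
  destruct (Hk sin (continuity_sin t) e He') as [d2 [Hd2 H2]].
  exists (Rmin e (Rmin d1 d2)). split.
  { repeat apply Rmin_glb_lt; trivial. }
  intros r' t' Hr' Ht'. apply H'.
  assert (A1 := Rmin_l e (Rmin d1 d2)). assert (A2 := Rmin_r e (Rmin d1 d2)).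
  assert (A3 := Rmin_l d1 d2). assert (A4 := Rmin_r d1 d2).
  specialize (H1 t' ltac:(lra)). specialize (H2 t' ltac:(lra)).
  replace (Cminus (circ r' t') (circ r t)) with
    (Cplus (circ (r' - r) t') (Cmult (RtoC r) (cos t' - cos t, sin t' - sin t)))
    by (apply injective_projections; simpl; ring).
  eapply Rle_lt_trans; [apply Cmod_triangle|].
  assert (B1 : Cmod (circ (r' - r) t') <= 2 * e).
  { eapply Rle_trans; [apply Cmod_le_abs_sum|]. rewrite !Rabs_mult.
    assert (C1 : Rabs (cos t') <= 1) by (apply Rabs_le, COS_bound).
    assert (C2 : Rabs (sin t') <= 1) by (apply Rabs_le, SIN_bound).
    assert (C3 := Rabs_pos (cos t')). assert (C4 := Rabs_pos (sin t')).
    assert (C5 := Rabs_pos (r' - r)). nra. }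
  assert (B2 : Cmod (Cmult (RtoC r) (cos t' - cos t, sin t' - sin t)) <= Rabs r * (2 * e)).
  { rewrite Cmod_mult, Cmod_R. apply Rmult_le_compat_l; trivial.
    eapply Rle_trans; [apply Cmod_le_abs_sum|]. lra. }
  replace d with (e * (2 * (Rabs r + 2))) by (unfold e; field; lra).
  nra.
Qed.

Lemma circle_int_ok (g : C -> C) (r : R) : 0 <= r ->
  (forall z, Cmod z = r -> Ccont g z) -> cint_ok (fun t => g (circ r t)) 0 (2 * PI).
Proof.
  intros Hr H. apply cint_ok_continuous; [apply Rlt_le, two_PI_pos|].
  intros t _. apply continuous_C_iff. intros eps He.
  destruct (continuous_circ g r t (H _ (Cmod_circ r t Hr)) eps He) as [d [Hd H']].
  exists (mkposreal d Hd). intros t' Ht'. apply H'; trivial.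
  rewrite Rminus_diag, Rabs_R0. exact Hd.
Qed.

Lemma circle_int_bound (g : C -> C) (r K : R) : 0 <= r ->
  (forall z, Cmod z = r -> Ccont g z) -> (forall z, Cmod z = r -> Cmod (g z) <= K) ->
  Cmod (circle_int g r) <= 2 * PI * K.
Proof.
  intros Hr Hg HK. replace (2 * PI) with (2 * PI - 0) at 1 by ring.
  apply Cint_bound.
  - apply Rlt_le, two_PI_pos.
  - now apply circle_int_ok.
  - intros t _. now apply HK, Cmod_circ.
Qed.

(* Pulled back by [cexp], the annulus becomes a rectangle whose two horizontal sides
   cancel by periodicity. *)
Lemma circle_int_annulus (g : C -> C) (a b : R) : 0 < a -> a <= b ->
  (forall z, a <= Cmod z <= b -> Cder g z) -> circle_int g a = circle_int g b.
Proof.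
  intros Ha Hab Hg.
  pose (h := fun z => g (cexp z)).
  assert (Hln : ln a <= ln b) by now apply ln_le.
  assert (Hh : forall x y, ln a <= x <= ln b -> 0 <= y <= 2 * PI -> Cder h (x, y)).
  { intros x y Hx _. apply (Cder_comp g cexp); [|apply Cder_cexp]. apply Hg.
    unfold cexp; simpl. rewrite Cmod_circ by apply Rlt_le, exp_pos.
    rewrite <- (exp_ln a), <- (exp_ln b) by lra.
    assert (Hle : forall u v, u <= v -> exp u <= exp v).
    { intros u v [H|H]; [left; now apply exp_increasing | right; now f_equal]. }
    split; apply Hle; lra. }
  assert (H := goursat h (ln a) (ln b) 0 (2 * PI) Hln (Rlt_le _ _ two_PI_pos) Hh).
  assert (Hper : forall x, h (x, 0) = h (x, 2 * PI)).
  { intros x. unfold h, cexp, circ; simpl. now rewrite cos_2PI, sin_2PI, cos_0, sin_0. }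
  assert (Hv : forall x, ln a <= x <= ln b -> cint_ok (fun y => h (x, y)) 0 (2 * PI)).
  { intros x Hx. apply cint_ok_continuous; [apply Rlt_le, two_PI_pos|].
    intros y Hy. now apply continuous_vline, Hh. }
  unfold rect_int in H.
  rewrite (Cint_ext _ (fun _ => RtoC 0) (ln a) (ln b)) in H.
  2: exact Hln.
  2: { intros x _. rewrite Hper. ring. }
  rewrite Cint_const, (Cint_minus _ _ _ _ (Hv (ln b) ltac:(lra)) (Hv (ln a) ltac:(lra))) in H.
  unfold h, cexp in H; cbn [fst snd] in H. rewrite !exp_ln in H by lra.
  fold (circle_int g a) (circle_int g b) in H.
  assert (E : Cminus (circle_int g b) (circle_int g a) = RtoC 0).
  { replace (Cminus (circle_int g b) (circle_int g a)) with
     (Cmult (Copp Ci) (Cplus (Cmult (RtoC (ln b - ln a)) (RtoC 0))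
       (Cmult Ci (Cminus (circle_int g b) (circle_int g a)))))
     by (apply injective_projections; simpl; ring).
    rewrite H. ring. }
  replace (circle_int g b) with (Cplus (circle_int g a) (Cminus (circle_int g b) (circle_int g a))) by ring.
  rewrite E. ring.
Qed.

(** Continuity at each point of the circle becomes uniform in the angle by compactness of [0, 2 pi].
    Integrability at radius r is assumed separately, since g is continuous only on the circle of
    radius r0. *)
Lemma circle_int_continuous (g : C -> C) (r0 : R) : 0 <= r0 ->
  (forall z, Cmod z = r0 -> Ccont g z) ->
  forall eps, 0 < eps -> exists d, 0 < d /\ forall r, Rabs (r - r0) < d ->
    cint_ok (fun t => g (circ r t)) 0 (2 * PI) ->
    Cmod (Cminus (circle_int g r) (circle_int g r0)) <= eps.
Proof.
  intros Hr Hg eps0 He0.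
  assert (HPI := two_PI_pos).
  set (eps := eps0 / (2 * PI)).
  assert (He : 0 < eps / 2) by (unfold eps; repeat apply Rdiv_lt_0_compat; lra).
  assert (Hd : forall t, exists d : posreal, forall r' t', Rabs (r' - r0) < d -> Rabs (t' - t) < d ->
    Cmod (Cminus (g (circ r' t')) (g (circ r0 t))) < eps / 2).
  { intros t. destruct (continuous_circ g r0 t (Hg _ (Cmod_circ r0 t Hr)) _ He) as [d [Hd H]].
    now exists (mkposreal d Hd). }
  pose (delta := fun t => proj1_sig (constructive_indefinite_description _ (Hd t))).
  assert (Hdelta : forall t r' t', Rabs (r' - r0) < delta t -> Rabs (t' - t) < delta t ->
    Cmod (Cminus (g (circ r' t')) (g (circ r0 t))) < eps / 2).
  { intros t. exact (proj2_sig (constructive_indefinite_description _ (Hd t))). }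
  destruct (compactness_value_1d 0 (2 * PI) delta) as [d Hcov].
  exists d. split; [apply cond_pos|]. intros r Hrr Hok.
  unfold circle_int. rewrite <- Cint_minus; trivial; [|now apply circle_int_ok].
  replace eps0 with ((2 * PI - 0) * eps) by (unfold eps; field; lra).
  apply Cint_bound; [lra| |].
  - apply cint_ok_minus; trivial. now apply circle_int_ok.
  (* The covering property holds only up to double negation, so the inequality is proved by
     contradiction. *)
  - intros t Ht. apply Rnot_lt_le. intros Hlt. apply (Hcov t Ht).
    intros [s [_ [Hs1 Hs2]]]. revert Hlt. apply Rle_not_lt.
    replace (Cminus (g (circ r t)) (g (circ r0 t))) with
      (Cminus (Cminus (g (circ r t)) (g (circ r0 s))) (Cminus (g (circ r0 t)) (g (circ r0 s)))) by ring.
    eapply Rle_trans; [apply Cmod_triangle_sub|].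
    assert (H1 := Hdelta s r t ltac:(lra) Hs1).
    assert (H2 := Hdelta s r0 t ltac:(rewrite Rminus_diag, Rabs_R0; apply cond_pos) Hs1).
    lra.
Qed.

Lemma circle_int_0 (g : C -> C) : circle_int g 0 = Cmult (RtoC (2 * PI)) (g (RtoC 0)).
Proof.
  unfold circle_int. rewrite (Cint_ext _ (fun _ => g (RtoC 0))).
  - rewrite Cint_const. now rewrite Rminus_0_r.
  - apply Rlt_le, two_PI_pos.
  - intros t _. unfold circ. now rewrite !Rmult_0_l.
Qed.

Lemma circle_int_ext (f g : C -> C) (r : R) : 0 <= r ->
  (forall z, Cmod z = r -> f z = g z) -> circle_int f r = circle_int g r.
Proof.
  intros Hr H. apply Cint_ext; [apply Rlt_le, two_PI_pos|].
  intros t _. now apply H, Cmod_circ.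
Qed.

Lemma circle_int_limit (g : C -> C) (r0 : R) (L : C) : 0 <= r0 ->
  (forall z, Cmod z = r0 -> Ccont g z) ->
  (forall d, 0 < d -> exists r, 0 <= r /\ Rabs (r - r0) < d /\
     (forall z, Cmod z = r -> Ccont g z) /\ circle_int g r = L) ->
  circle_int g r0 = L.
Proof.
  intros Hr Hg H.
  assert (Cminus L (circle_int g r0) = RtoC 0) as E.
  { apply Cmod_eq_0, Rle_antisym; [|apply Cmod_ge_0].
    apply le_epsilon. intros eps He. rewrite Rplus_0_l.
    destruct (circle_int_continuous g r0 Hr Hg eps He) as [d [Hd Hc]].
    destruct (H d Hd) as [r [H1 [H2 [H3 <-]]]]. apply Hc; trivial. now apply circle_int_ok. }
  replace (circle_int g r0) with (Cminus L (Cminus L (circle_int g r0))) by ring.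
  rewrite E. ring.
Qed.

(* The mean is constant on either side of the circle through [p], and continuous
   across it. *)
Lemma mean_value (g : C -> C) (p : C) (R0 r : R) :
  (forall z, Cmod z < R0 -> z <> p -> Cder g z) -> Ccont g p ->
  0 <= r < R0 -> circle_int g r = Cmult (RtoC (2 * PI)) (g (RtoC 0)).
Proof.
  intros Hg Hp Hr. rewrite <- circle_int_0.
  assert (Hc : forall s, s < R0 -> forall z, Cmod z = s -> Ccont g z).
  { intros s Hs z Hz. destruct (Ceq_dec z p) as [->|Hne]; trivial.
    apply Cder_Ccont, Hg; trivial. lra. }
  assert (Hann : forall s t, 0 < s -> s <= t -> t < R0 -> (t < Cmod p \/ Cmod p < s) ->
            circle_int g s = circle_int g t).
  { intros s t Hs Hst Ht Hsp. apply circle_int_annulus; trivial.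
    intros z Hz. apply Hg; [lra|]. intros ->. lra. }
  assert (Hpos := Cmod_ge_0 p).
  (* [circle_int_annulus] wants a positive inner radius, so radius 0 is reached as a limit. When p =
     0 this claim is vacuous, [Hon] is trivial, and the limit is taken in the last case instead. *)
  assert (Hin : forall s, 0 <= s < R0 -> s < Cmod p -> circle_int g s = circle_int g 0).
  { intros s Hs Hsp. destruct (Req_dec s 0) as [->|Hs0]; trivial.
    symmetry. apply circle_int_limit; [lra | apply Hc; lra|].
    intros d Hd. exists (Rmin s (d / 2)).
    assert (A1 := Rmin_l s (d / 2)). assert (A2 := Rmin_r s (d / 2)).
    assert (A3 : 0 < Rmin s (d / 2)) by (apply Rmin_glb_lt; lra).
    repeat split; [lra | | apply Hc; lra | apply Hann; lra].
    rewrite Rminus_0_r, Rabs_pos_eq; lra. }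
  assert (Hon : Cmod p < R0 -> circle_int g (Cmod p) = circle_int g 0).
  { intros HpR. destruct (Req_dec (Cmod p) 0) as [->|Hp0]; trivial.
    apply circle_int_limit; [lra | apply Hc; lra|].
    intros d Hd. exists (Cmod p - Rmin (Cmod p) (d / 2)).
    assert (A1 := Rmin_l (Cmod p) (d / 2)). assert (A2 := Rmin_r (Cmod p) (d / 2)).
    assert (A3 : 0 < Rmin (Cmod p) (d / 2)) by (apply Rmin_glb_lt; lra).
    repeat split; [lra | | apply Hc; lra | apply Hin; lra].
    rewrite Rabs_left; lra. }
  destruct (Rtotal_order r (Cmod p)) as [Hlt|[->|Hgt]].
  - now apply Hin.
  - now apply Hon.
  - rewrite <- Hon by lra. symmetry. apply circle_int_limit; [lra | apply Hc; lra|].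
    intros d Hd. exists (Cmod p + Rmin (r - Cmod p) (d / 2)).
    assert (A1 := Rmin_l (r - Cmod p) (d / 2)). assert (A2 := Rmin_r (r - Cmod p) (d / 2)).
    assert (A3 : 0 < Rmin (r - Cmod p) (d / 2)) by (apply Rmin_glb_lt; lra).
    repeat split; [lra | | apply Hc; lra | apply Hann; lra].
    rewrite Rabs_pos_eq; lra.
Qed.

(** With l the derivative at p, the quotient is continuous at p. That is all [mean_value] asks
    there, so no removable singularity theorem enters. *)
Definition Cslope (f : C -> C) (p l z : C) : C :=
  if Ceq_dec z p then l else Cdiv (Cminus (f z) (f p)) (Cminus z p).

Lemma Cminus_neq_0 (z w : C) : z <> w -> Cminus z w <> RtoC 0.
Proof.
  intros H E. apply H. replace z with (Cplus (Cminus z w) w) by ring. rewrite E. ring.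
Qed.

Lemma Cslope_ne (f : C -> C) (p l z : C) : z <> p ->
  Cslope f p l z = Cdiv (Cminus (f z) (f p)) (Cminus z p).
Proof. intros H. unfold Cslope. destruct (Ceq_dec z p); [contradiction | reflexivity]. Qed.

Lemma Cslope_cont (f : C -> C) (p l : C) :
  is_derive (K := C_AbsRing) (V := C_NormedModule) f p l -> Ccont (Cslope f p l) p.
Proof.
  intros H eps He. destruct (proj1 (is_derive_C_iff f p l) H (eps / 2) ltac:(lra)) as [d [Hd H']].
  exists d. split; trivial. intros w Hw. specialize (H' w Hw).
  unfold Cslope at 2. destruct (Ceq_dec p p) as [_|n]; [|now destruct n].
  unfold Cslope. destruct (Ceq_dec w p) as [->|Hne].
  - replace (Cminus l l) with (RtoC 0) by ring. rewrite Cmod_0. exact He.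
  - assert (Hwp := Cminus_neq_0 _ _ Hne).
    replace (Cminus (Cdiv (Cminus (f w) (f p)) (Cminus w p)) l) with
      (Cdiv (Cminus (Cminus (f w) (f p)) (Cmult l (Cminus w p))) (Cminus w p)) by (field; trivial).
    rewrite Cmod_div by trivial. apply Cmod_gt_0 in Hwp.
    apply Rle_lt_trans with (eps / 2); [|lra]. now apply Rle_div_l.
Qed.

Lemma Cder_Cslope (f : C -> C) (p l z : C) : z <> p -> Cder f z -> Cder (Cslope f p l) z.
Proof.
  intros Hne Hf.
  apply (ex_derive_ext_loc (K := C_AbsRing) (V := C_NormedModule)
    (fun w => Cdiv (Cminus (f w) (f p)) (Cminus w p))).
  - apply locally_C_AbsRing_iff. exists (Cmod (Cminus z p)). split.
    + now apply Cmod_gt_0, Cminus_neq_0.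
    + intros w Hw. symmetry. apply Cslope_ne. intros ->.
      rewrite Cmod_minus_sym in Hw. lra.
  - apply Cder_div.
    + apply Cder_minus; trivial. apply Cder_const.
    + apply Cder_minus; [apply Cder_id | apply Cder_const].
    + now apply Cminus_neq_0.
Qed.

Lemma Ccont_id_mult (f : C -> C) (p : C) : Ccont f p -> Ccont (fun z => Cmult z (f z)) p.
Proof.
  intros H eps He. 
  set (K := Cmod p + Cmod (f p) + 2).
  assert (H1 := Cmod_ge_0 p). assert (H2 := Cmod_ge_0 (f p)).
  assert (HK : 0 < K) by (unfold K; lra).
  assert (HeK : 0 < Rmin 1 (eps / K)) by (apply Rmin_glb_lt; [lra | now apply Rdiv_lt_0_compat]).
  destruct (H _ HeK) as [d [Hd H']].
  exists (Rmin d (Rmin 1 (eps / K))). split; [now apply Rmin_glb_lt|].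
  intros w Hw.
  assert (A1 := Rmin_l d (Rmin 1 (eps / K))). assert (A2 := Rmin_r d (Rmin 1 (eps / K))).
  assert (A3 := Rmin_l 1 (eps / K)). assert (A4 := Rmin_r 1 (eps / K)).
  specialize (H' w ltac:(lra)).
  replace (Cminus (Cmult w (f w)) (Cmult p (f p))) with
    (Cplus (Cmult (Cplus p (Cminus w p)) (Cminus (f w) (f p))) (Cmult (Cminus w p) (f p))) by ring.
  eapply Rle_lt_trans; [apply Cmod_triangle|]. rewrite !Cmod_mult.
  assert (H3 := Cmod_triangle p (Cminus w p)).
  set (e := Rmin 1 (eps / K)) in *.
  assert (HE : K * e <= eps).
  { apply (Rmult_le_compat_l K) in A4; [|lra]. replace (K * (eps / K)) with eps in A4 by (field; lra). exact A4. }
  assert (P1 : Cmod (Cplus p (Cminus w p)) * Cmod (Cminus (f w) (f p)) <= (Cmod p + 1) * e).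
  { apply Rmult_le_compat; try apply Cmod_ge_0; lra. }
  assert (P2 : Cmod (Cminus w p) * Cmod (f p) <= e * Cmod (f p)).
  { apply Rmult_le_compat_r; lra. }
  unfold K in HE. lra.
Qed.

Lemma circle_int_minus (f g : C -> C) (r : R) : 0 <= r ->
  (forall z, Cmod z = r -> Ccont f z) -> (forall z, Cmod z = r -> Ccont g z) ->
  circle_int (fun z => Cminus (f z) (g z)) r = Cminus (circle_int f r) (circle_int g r).
Proof.
  intros Hr Hf Hg. apply (Cint_minus (fun t => f (circ r t)) (fun t => g (circ r t)));
    now apply circle_int_ok.
Qed.

Lemma circle_int_Cmult (f : C -> C) (c : C) (r : R) : 0 <= r ->
  (forall z, Cmod z = r -> Ccont f z) ->
  circle_int (fun z => Cmult c (f z)) r = Cmult c (circle_int f r).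
Proof.
  intros Hr Hf. apply (Cint_Cmult (fun t => f (circ r t))). now apply circle_int_ok.
Qed.

(** On a circle about 0, dz / (i (z - p)) equals this kernel times dt. *)
Definition cauchy_kernel (p z : C) : C := Cdiv z (Cminus z p).

Lemma Cder_cauchy_kernel (p z : C) : z <> p -> Cder (cauchy_kernel p) z.
Proof.
  intros H. apply (Cder_div (fun z => z) (fun z => Cminus z p)).
  - apply Cder_id.
  - apply Cder_minus; [apply Cder_id | apply Cder_const].
  - now apply Cminus_neq_0.
Qed.

(* The kernel tends to 1 at infinity and its circle integral does not depend on
   the radius. *)
Lemma circle_int_cauchy_kernel (p : C) (r : R) : Cmod p < r ->
  circle_int (cauchy_kernel p) r = RtoC (2 * PI).
Proof.
  intros Hr. assert (Hp := Cmod_ge_0 p). assert (HPI := two_PI_pos).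
  assert (Hne : forall z, Cmod p < Cmod z -> z <> p) by (intros z Hz ->; lra).
  assert (E : Cminus (circle_int (cauchy_kernel p) r) (RtoC (2 * PI)) = RtoC 0).
  { apply Cmod_eq_0, Rle_antisym; [|apply Cmod_ge_0].
    apply le_epsilon. intros eps He. rewrite Rplus_0_l.
    (* On |z| = s the kernel differs from 1 by p / (z - p), so the error is at most 2 pi |p| / (s -
       |p|); as r > |p|, this s makes it at most eps. *)
    set (s := r + 2 * PI * Cmod p / eps).
    assert (Hs0 : 0 <= 2 * PI * Cmod p / eps) by (apply Rdiv_le_0_compat; nra).
    assert (Hs : r <= s) by (unfold s; lra).
    rewrite (circle_int_annulus (cauchy_kernel p) r s); [|lra|trivial|].
    2: { intros z Hz. apply Cder_cauchy_kernel, Hne. lra. }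
    assert (Hc : forall z, Cmod z = s -> Ccont (cauchy_kernel p) z).
    { intros z Hz. apply Cder_Ccont, Cder_cauchy_kernel, Hne. lra. }
    assert (H1 : forall z, Cmod z = s -> Ccont (fun _ => RtoC 1) z).
    { intros z _. apply Cder_Ccont, Cder_const. }
    replace (RtoC (2 * PI)) with (circle_int (fun _ => RtoC 1) s).
    2: { unfold circle_int. rewrite Cint_const, Rminus_0_r. ring. }
    rewrite <- circle_int_minus by (trivial; lra).
    apply Rle_trans with (2 * PI * (Cmod p / (s - Cmod p))).
    - apply circle_int_bound; [lra | |].
      + intros z Hz. apply Cder_Ccont, Cder_minus; [|apply Cder_const].
        apply Cder_cauchy_kernel, Hne. lra.
      + intros z Hz. assert (Hzp := Cminus_neq_0 z p (Hne z ltac:(lra))).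
        unfold cauchy_kernel.
        replace (Cminus (Cdiv z (Cminus z p)) (RtoC 1)) with (Cdiv p (Cminus z p)) by (field; trivial).
        rewrite Cmod_div by trivial.
        assert (H := Cmod_sub_ge z p). rewrite Hz in H.
        apply Rmult_le_compat_l; trivial. apply Rinv_le_contravar; lra.
    - replace (2 * PI * (Cmod p / (s - Cmod p))) with ((2 * PI * Cmod p) / (s - Cmod p)) by (field; lra).
      apply Rle_div_l; [lra|].
      replace (2 * PI * Cmod p) with (2 * PI * Cmod p / eps * eps) by (field; lra).
      unfold s. nra. }
  replace (circle_int (cauchy_kernel p) r) with
    (Cplus (Cminus (circle_int (cauchy_kernel p) r) (RtoC (2 * PI))) (RtoC (2 * PI))) by ring.
  rewrite E. ring.
Qed.

(** The function z (f(z) - f(p)) / (z - p) vanishes at 0, so its mean over the circle is 0; it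
    equals f(z) - f(p) times the kernel, and the kernel has mean 1. *)
Theorem cauchy_formula (f : C -> C) (p : C) (r R0 : R) :
  (forall z, Cmod z < R0 -> Cder f z) -> Cmod p < r -> r < R0 ->
  circle_int (fun z => Cmult (f z) (cauchy_kernel p z)) r = Cmult (RtoC (2 * PI)) (f p).
Proof.
  intros Hf Hp Hr. assert (Hp0 := Cmod_ge_0 p).
  destruct (Hf p ltac:(lra)) as [l Hl].
  assert (Hne : forall z, Cmod z = r -> z <> p) by (intros z Hz ->; lra).
  assert (Hk : forall z, Cmod z = r -> Cder (cauchy_kernel p) z).
  { intros z Hz. now apply Cder_cauchy_kernel, Hne. }
  assert (H := mean_value (fun z => Cmult z (Cslope f p l z)) p R0 r).
  cbv beta in H. rewrite Cmult_0_l, Cmult_0_r in H.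
  rewrite (circle_int_ext _ (fun z => Cminus (Cmult (f z) (cauchy_kernel p z)) (Cmult (f p) (cauchy_kernel p z)))) in H.
  - rewrite circle_int_minus, circle_int_Cmult, circle_int_cauchy_kernel in H; try lra.
    + replace (circle_int (fun z => Cmult (f z) (cauchy_kernel p z)) r) with
       (Cplus (Cminus (circle_int (fun z => Cmult (f z) (cauchy_kernel p z)) r) (Cmult (f p) (RtoC (2 * PI))))
          (Cmult (f p) (RtoC (2 * PI)))) by ring.
      rewrite H; [ring | | | lra].
      * intros z Hz Hzp. apply Cder_mult; [apply Cder_id|]. apply Cder_Cslope; trivial. now apply Hf.
      * now apply Ccont_id_mult, Cslope_cont.
    + intros z Hz. now apply Cder_Ccont, Hk.
    + intros z Hz. apply Cder_Ccont, Cder_mult; [apply Hf; lra | now apply Hk].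
    + intros z Hz. apply Cder_Ccont, Cder_mult; [apply Cder_const | now apply Hk].
  - lra.
  - intros z Hz. rewrite Cslope_ne by now apply Hne. unfold cauchy_kernel, Cdiv. ring.
Qed.

(** The mean value property of the slope at 0, whose value at the centre is l. *)
Lemma cauchy_formula_derive_0 (f : C -> C) (l : C) (r R0 : R) :
  (forall z, Cmod z < R0 -> Cder f z) -> f (RtoC 0) = RtoC 0 ->
  is_derive (K := C_AbsRing) (V := C_NormedModule) f (RtoC 0) l ->
  0 < r < R0 -> circle_int (fun z => Cdiv (f z) z) r = Cmult (RtoC (2 * PI)) l.
Proof.
  intros Hf Hf0 Hl Hr.
  assert (H := mean_value (Cslope f (RtoC 0) l) (RtoC 0) R0 r).
  assert (E : Cslope f (RtoC 0) l (RtoC 0) = l).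
  { unfold Cslope. destruct (Ceq_dec (RtoC 0) (RtoC 0)) as [_|n]; [reflexivity | now destruct n]. }
  rewrite E in H. rewrite <- H.
  - apply circle_int_ext; [lra|]. intros z Hz.
    rewrite Cslope_ne, Hf0.
    + f_equal; ring.
    + intros ->. rewrite Cmod_0 in Hz. lra.
  - intros z Hz Hz0. apply Cder_Cslope; auto.
  - now apply Cslope_cont.
  - lra.
Qed.

(** * Estimates for bounded normalized analytic functions *)

(** All three formulas integrate f against a kernel, so |f| <= M factors out of their combination
    and only the combined kernel has to be bounded. *)
Lemma cauchy_estimate (f : C -> C) (l p q c : C) (M B r R0 : R) :
  (forall z, Cmod z < R0 -> Cder f z) ->
  f (RtoC 0) = RtoC 0 ->
  is_derive (K := C_AbsRing) (V := C_NormedModule) f (RtoC 0) l ->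
  (forall z, Cmod z < R0 -> Cmod (f z) <= M) ->
  Cmod p < r -> Cmod q < r -> r < R0 ->
  (forall z, Cmod z = r ->
     Cmod (Cminus (Cminus (cauchy_kernel p z) (cauchy_kernel q z)) (Cdiv c z)) <= B) ->
  Cmod (Cminus (Cminus (f p) (f q)) (Cmult c l)) <= M * B.
Proof.
  intros Hf Hf0 Hl HM Hp Hq Hr HB.
  assert (Hp0 := Cmod_ge_0 p). assert (HPI := two_PI_pos).
  assert (Hder : forall s z, Cmod s < r -> Cmod z = r -> Cder (cauchy_kernel s) z).
  { intros s z Hs Hz. apply Cder_cauchy_kernel. intros ->. lra. }
  assert (Hz0 : forall z, Cmod z = r -> z <> RtoC 0).
  { intros z Hz ->. rewrite Cmod_0 in Hz. lra. }
  assert (Hfz : forall z, Cmod z = r -> Cder (fun w => Cdiv (f w) w) z).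
  { intros z Hz. apply Cder_div; [apply Hf; lra | apply Cder_id | now apply Hz0]. }
  assert (Hfk : forall s z, Cmod s < r -> Cmod z = r ->
            Cder (fun w => Cmult (f w) (cauchy_kernel s w)) z).
  { intros s z Hs Hz. apply Cder_mult; [apply Hf; lra | now apply Hder]. }
  pose (g := fun z => Cminus (Cminus (Cmult (f z) (cauchy_kernel p z)) (Cmult (f z) (cauchy_kernel q z)))
      (Cmult c (Cdiv (f z) z))).
  assert (E : circle_int g r = Cmult (RtoC (2 * PI)) (Cminus (Cminus (f p) (f q)) (Cmult c l))).
  { unfold g. rewrite circle_int_minus, circle_int_minus, circle_int_Cmult.
    - rewrite (cauchy_formula f p r R0), (cauchy_formula f q r R0),
        (cauchy_formula_derive_0 f l r R0) by (trivial; lra). ring.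
    - lra.
    - intros z Hz. now apply Cder_Ccont, Hfz.
    - lra.
    - intros z Hz. now apply Cder_Ccont, Hfk.
    - intros z Hz. now apply Cder_Ccont, Hfk.
    - lra.
    - intros z Hz. apply Cder_Ccont, Cder_minus; now apply Hfk.
    - intros z Hz. apply Cder_Ccont, Cder_mult; [apply Cder_const | now apply Hfz]. }
  assert (H : Cmod (circle_int g r) <= 2 * PI * (M * B)).
  { apply circle_int_bound; [lra| |].
    - intros z Hz. apply Cder_Ccont, Cder_minus; [apply Cder_minus; now apply Hfk|].
      apply Cder_mult; [apply Cder_const | now apply Hfz].
    - intros z Hz. unfold g.
      replace (Cminus (Cminus (Cmult (f z) (cauchy_kernel p z)) (Cmult (f z) (cauchy_kernel q z)))
        (Cmult c (Cdiv (f z) z))) with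
        (Cmult (f z) (Cminus (Cminus (cauchy_kernel p z) (cauchy_kernel q z)) (Cdiv c z)))
        by (unfold Cdiv; ring).
      rewrite Cmod_mult. apply Rmult_le_compat; try apply Cmod_ge_0; [apply HM; lra | now apply HB]. }
  rewrite E, Cmod_mult, Cmod_R, Rabs_pos_eq in H by lra.
  now apply Rmult_le_reg_l in H.
Qed.

Lemma le_left_limit (phi : R -> R) (X a b : R) : a < b -> continuity_pt phi b ->
  (forall r, a < r < b -> X <= phi r) -> X <= phi b.
Proof.
  intros Hab Hc H. apply le_epsilon. intros eps He.
  destruct (proj1 (continuity_pt_locally phi b) Hc (mkposreal eps He)) as [[d Hd] Hl].
  set (r := b - Rmin (b - a) d / 2).
  assert (A1 := Rmin_l (b - a) d). assert (A2 := Rmin_r (b - a) d).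
  assert (A3 : 0 < Rmin (b - a) d) by (apply Rmin_glb_lt; lra).
  specialize (H r ltac:(unfold r; lra)).
  assert (Hb : Rabs (r - b) < d) by (unfold r; rewrite Rabs_left; lra).
  specialize (Hl r Hb). simpl in Hl. apply Rabs_def2 in Hl. lra.
Qed.

Definition normalized_bounded (f : C -> C) (M : R) : Prop :=
  analytic_on (disk 1) f /\ f (RtoC 0) = RtoC 0 /\
  is_derive (K := C_AbsRing) (V := C_NormedModule) f (RtoC 0) (RtoC 1) /\
  (forall z, disk 1 z -> Cmod (f z) <= M).

(* [cauchy_estimate] on circles of radius tending to 1. *)
Lemma cauchy_estimate_lim (f : C -> C) (M : R) (p q c : C) (rho : R) (phi : R -> R) :
  normalized_bounded f M -> rho < 1 -> Cmod p <= rho -> Cmod q <= rho ->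
  continuity_pt phi 1 ->
  (forall r z, rho < r < 1 -> Cmod z = r ->
     Cmod (Cminus (Cminus (cauchy_kernel p z) (cauchy_kernel q z)) (Cdiv c z)) <= phi r) ->
  Cmod (Cminus (Cminus (f p) (f q)) c) <= M * phi 1.
Proof.
  intros [Hf [Hf0 [Hl HM]]] Hrho Hp Hq Hphi HB.
  apply (le_left_limit (fun r => M * phi r) _ rho); trivial.
  - now apply continuity_pt_scal.
  - intros r Hr. rewrite <- (Cmult_1_r c).
    apply (cauchy_estimate f (RtoC 1) p q c M (phi r) r 1); trivial; try lra.
    intros z Hz. now apply HB.
Qed.

Lemma Cmod_div_sub_le (p q z : C) (rho r : R) : Cmod p <= rho -> Cmod q <= rho -> rho < r -> Cmod z = r ->
  Cmod (Cdiv p (Cminus z q)) <= rho / (r - rho).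
Proof.
  intros Hp Hq Hr Hz.
  assert (Hzq : Cminus z q <> RtoC 0) by (apply Cminus_neq_0; intros ->; lra).
  rewrite Cmod_div by trivial. assert (H := Cmod_sub_ge z q).
  assert (Hp0 := Cmod_ge_0 p).
  apply Rmult_le_compat; trivial.
  - apply Rlt_le, Rinv_0_lt_compat. lra.
  - apply Rinv_le_contravar; lra.
Qed.

Lemma ex_derive_continuity_pt (phi : R -> R) (x : R) : ex_derive phi x -> continuity_pt phi x.
Proof. intros H. apply continuity_pt_filterlim. exact (ex_derive_continuous phi x H). Qed.

(** With q = 0 and c = 0 the kernel is p / (z - p). *)
Lemma normalized_bounded_growth (f : C -> C) (M rho : R) (p : C) :
  normalized_bounded f M -> rho < 1 -> Cmod p <= rho ->
  Cmod (f p) <= M * (rho / (1 - rho)).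
Proof.
  intros Hf Hrho Hp. assert (Hp0 := Cmod_ge_0 p).
  replace (f p) with (Cminus (Cminus (f p) (f (RtoC 0))) (RtoC 0)).
  2: { destruct Hf as [_ [-> _]]. ring. }
  apply (cauchy_estimate_lim f M p (RtoC 0) (RtoC 0) rho (fun r => rho / (r - rho))); trivial.
  - rewrite Cmod_0. lra.
  - apply ex_derive_continuity_pt. auto_derive. lra.
  - intros r z Hr Hz.
    replace (Cminus (Cminus (cauchy_kernel p z) (cauchy_kernel (RtoC 0) z)) (Cdiv (RtoC 0) z))
      with (Cdiv p (Cminus z p)).
    + apply Cmod_div_sub_le; trivial. lra.
    + unfold cauchy_kernel. field. split.
      * intros ->. rewrite Cmod_0 in Hz. lra.
      * apply Cminus_neq_0. intros ->. lra.
Qed.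

(** With q = 0 and c = p the kernel is (p / z) (p / (z - p)): subtracting the linear term gains one
    more factor p. *)
Lemma normalized_bounded_id (f : C -> C) (M rho : R) (p : C) :
  normalized_bounded f M -> rho < 1 -> Cmod p <= rho ->
  Cmod (Cminus (f p) p) <= M * (rho ^ 2 / (1 - rho)).
Proof.
  intros Hf Hrho Hp. assert (Hp0 := Cmod_ge_0 p).
  replace (f p) with (Cminus (f p) (f (RtoC 0))).
  2: { destruct Hf as [_ [-> _]]. ring. }
  (* Written as the value at r = 1 of the bound depending on r; the 1 in [rho / 1] stands for r. *)
  replace (rho ^ 2 / (1 - rho)) with (rho / 1 * (rho / (1 - rho))) by (field; lra).
  apply (cauchy_estimate_lim f M p (RtoC 0) p rho (fun r => rho / r * (rho / (r - rho)))); trivial.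
  - rewrite Cmod_0. lra.
  - apply ex_derive_continuity_pt. auto_derive. lra.
  - intros r z Hr Hz.
    assert (Hz0 : z <> RtoC 0) by (intros ->; rewrite Cmod_0 in Hz; lra).
    replace (Cminus (Cminus (cauchy_kernel p z) (cauchy_kernel (RtoC 0) z)) (Cdiv p z))
      with (Cmult (Cdiv p z) (Cdiv p (Cminus z p))).
    + rewrite Cmod_mult. apply Rmult_le_compat; try apply Cmod_ge_0.
      * rewrite Cmod_div, Hz by trivial. apply Rmult_le_compat_r; trivial.
        apply Rlt_le, Rinv_0_lt_compat. lra.
      * apply Cmod_div_sub_le; trivial. lra.
    + unfold cauchy_kernel. field. split; trivial.
      apply Cminus_neq_0. intros ->. lra.
Qed.

(** With c = 0 the kernel is (p - q) (z / (z - p)) / (z - q). Writing z / (z - p) = 1 + p / (z - p)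
    bounds each of the last two factors by 1 / (1 - rho) in the limit. *)
Lemma normalized_bounded_lipschitz (f : C -> C) (M rho : R) (p q : C) :
  normalized_bounded f M -> rho < 1 -> Cmod p <= rho -> Cmod q <= rho ->
  Cmod (Cminus (f p) (f q)) <= M * (Cmod (Cminus p q) / (1 - rho) ^ 2).
Proof.
  intros Hf Hrho Hp Hq. assert (Hp0 := Cmod_ge_0 p).
  replace (Cminus (f p) (f q)) with (Cminus (Cminus (f p) (f q)) (RtoC 0)) by ring.
  replace (Cmod (Cminus p q) / (1 - rho) ^ 2)
    with (Cmod (Cminus p q) * ((1 + rho / (1 - rho)) * (1 / (1 - rho)))) by (field; lra).
  apply (cauchy_estimate_lim f M p q (RtoC 0) rho
    (fun r => Cmod (Cminus p q) * ((1 + rho / (r - rho)) * (1 / (r - rho))))); trivial.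
  - apply ex_derive_continuity_pt. auto_derive. lra.
  - intros r z Hr Hz.
    assert (Hz0 : z <> RtoC 0) by (intros ->; rewrite Cmod_0 in Hz; lra).
    assert (Hzp : Cminus z p <> RtoC 0) by (apply Cminus_neq_0; intros ->; lra).
    assert (Hzq : Cminus z q <> RtoC 0) by (apply Cminus_neq_0; intros ->; lra).
    replace (Cminus (Cminus (cauchy_kernel p z) (cauchy_kernel q z)) (Cdiv (RtoC 0) z))
      with (Cmult (Cminus p q) (Cmult (Cplus (RtoC 1) (Cdiv p (Cminus z p))) (Cinv (Cminus z q))))
      by (unfold cauchy_kernel; field; auto).
    rewrite !Cmod_mult. apply Rmult_le_compat_l; [apply Cmod_ge_0|].
    apply Rmult_le_compat; try apply Cmod_ge_0.
    + eapply Rle_trans; [apply Cmod_triangle|]. rewrite Cmod_1.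
      apply Rplus_le_compat_l. apply Cmod_div_sub_le; trivial. lra.
    + rewrite Cmod_inv by trivial. assert (H := Cmod_sub_ge z q).
      unfold Rdiv. rewrite Rmult_1_l. apply Rinv_le_contravar; lra.
Qed.

(** With c = p - q the kernel is ((p - q) / z) ((1 + a) (1 + b) - 1), where a = p / (z - p) and b =
    q / (z - q). Expanding to a + b + a b before taking moduli keeps the -1, so the limit bound is 1
    / (1 - rho)^2 - 1 = rho (2 - rho) / (1 - rho)^2. *)
Lemma normalized_bounded_lipschitz_id (f : C -> C) (M rho : R) (p q : C) :
  normalized_bounded f M -> rho < 1 -> Cmod p <= rho -> Cmod q <= rho ->
  Cmod (Cminus (Cminus (f p) (f q)) (Cminus p q)) <=
    M * (Cmod (Cminus p q) * (rho * (2 - rho) / (1 - rho) ^ 2)).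
Proof.
  intros Hf Hrho Hp Hq. assert (Hp0 := Cmod_ge_0 p).
  replace (rho * (2 - rho) / (1 - rho) ^ 2)
    with (1 / 1 * (rho / (1 - rho) + rho / (1 - rho) + rho / (1 - rho) * (rho / (1 - rho)))) by (field; lra).
  apply (cauchy_estimate_lim f M p q (Cminus p q) rho
    (fun r => Cmod (Cminus p q) * (1 / r * (rho / (r - rho) + rho / (r - rho) + rho / (r - rho) * (rho / (r - rho)))))); trivial.
  - apply ex_derive_continuity_pt. auto_derive. lra.
  - intros r z Hr Hz.
    assert (Hz0 : z <> RtoC 0) by (intros ->; rewrite Cmod_0 in Hz; lra).
    assert (Hzp : Cminus z p <> RtoC 0) by (apply Cminus_neq_0; intros ->; lra).
    assert (Hzq : Cminus z q <> RtoC 0) by (apply Cminus_neq_0; intros ->; lra).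
    replace (Cminus (Cminus (cauchy_kernel p z) (cauchy_kernel q z)) (Cdiv (Cminus p q) z))
      with (Cmult (Cminus p q) (Cmult (Cinv z) (Cplus (Cplus (Cdiv p (Cminus z p)) (Cdiv q (Cminus z q)))
         (Cmult (Cdiv p (Cminus z p)) (Cdiv q (Cminus z q))))))
      by (unfold cauchy_kernel; field; auto).
    assert (B1 := Cmod_div_sub_le p p z rho r Hp Hp ltac:(lra) Hz).
    assert (B2 := Cmod_div_sub_le q q z rho r Hq Hq ltac:(lra) Hz).
    rewrite !Cmod_mult. apply Rmult_le_compat_l; [apply Cmod_ge_0|].
    apply Rmult_le_compat; try apply Cmod_ge_0.
    + rewrite Cmod_inv, Hz by trivial. right. field. lra.
    + repeat (eapply Rle_trans; [apply Cmod_triangle|]; apply Rplus_le_compat); trivial.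
      rewrite Cmod_mult. apply Rmult_le_compat; trivial; apply Cmod_ge_0.
Qed.

(** * Univalence and covering *)

Lemma C_complete_geometric (u : nat -> C) (K k : R) : 0 <= k < 1 ->
  (forall n, Cmod (Cminus (u (S n)) (u n)) <= K * k ^ n) ->
  exists z, forall eps, 0 < eps -> exists N, forall n, (N <= n)%nat -> Cmod (Cminus (u n) z) < eps.
Proof.
  intros Hk Hu.
  assert (Hs : ex_series (V := C_R_CompleteNormedModule) (fun n => Cminus (u (S n)) (u n))).
  { apply (ex_series_le (V := C_R_CompleteNormedModule) _ (fun n => K * k ^ n)).
    - intros n. specialize (Hu n). rewrite Cmod_norm in Hu. exact Hu.
    - apply (ex_series_scal (V := R_NormedModule)), ex_series_geom. rewrite Rabs_pos_eq; lra. }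
  destruct Hs as [s Hs].
  assert (Hsum : forall n, sum_n (G := C_R_CompleteNormedModule) (fun n => Cminus (u (S n)) (u n)) n
     = Cminus (u (S n)) (u 0%nat)).
  { induction n as [|n IH].
    - now rewrite sum_O.
    - rewrite sum_Sn, IH.
      change (Cplus (Cminus (u (S n)) (u 0%nat)) (Cminus (u (S (S n))) (u (S n)))
        = Cminus (u (S (S n))) (u 0%nat)). ring. }
  exists (Cplus s (u 0%nat)). intros eps He.
  assert (H := proj1 (filterlim_locally_ball_norm (K := R_AbsRing) (U := C_R_NormedModule) _ _) Hs
     (mkposreal eps He)).
  (* The telescoping sum up to n ends at [u (S n)], hence the shift by one. *)
  destruct H as [N HN]. exists (S N). intros [|n] Hn; [lia|].
  specialize (HN n ltac:(lia)). unfold ball_norm in HN. rewrite Hsum in HN.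
  rewrite Cmod_norm. simpl in HN.
  replace (Cminus (u (S n)) (Cplus s (u 0%nat))) with (Cminus (Cminus (u (S n)) (u 0%nat)) s) by ring.
  exact HN.
Qed.

(** Iteration from the centre: successive steps shrink like k^n, and the limit stays in the disk
    because the disk is closed. *)
Lemma disk_contraction_fixed_point (T : C -> C) (r k : R) : 0 <= r -> 0 <= k < 1 ->
  (forall z, Cmod z <= r -> Cmod (T z) <= r) ->
  (forall z w, Cmod z <= r -> Cmod w <= r ->
     Cmod (Cminus (T z) (T w)) <= k * Cmod (Cminus z w)) ->
  exists z, Cmod z <= r /\ T z = z.
Proof.
  intros Hr Hk Hin Hlip.
  pose (u := fun n => Nat.iter n T (RtoC 0)).
  assert (Hur : forall n, Cmod (u n) <= r).
  { induction n as [|n IH]; simpl; [rewrite Cmod_0; lra | now apply Hin]. }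
  destruct (C_complete_geometric u (Cmod (Cminus (u 1%nat) (u 0%nat))) k Hk) as [z Hz].
  { induction n as [|n IH]; [simpl; lra|].
    eapply Rle_trans; [apply (Hlip (u (S n)) (u n)); apply Hur|].
    simpl pow. apply (Rmult_le_compat_l k) in IH; lra. }
  assert (Hzr : Cmod z <= r).
  { apply le_epsilon. intros eps He. destruct (Hz eps He) as [N HN].
    specialize (HN N (le_n N)). specialize (Hur N).
    assert (H := Cmod_sub_ge z (u N)). rewrite Cmod_minus_sym in H. lra. }
  exists z. split; trivial.
  assert (E : Cminus (T z) z = RtoC 0).
  { apply Cmod_eq_0, Rle_antisym; [|apply Cmod_ge_0].
    apply le_epsilon. intros eps He. rewrite Rplus_0_l.
    destruct (Hz (eps / 2) ltac:(lra)) as [N HN].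
    assert (H1 := HN N ltac:(lia)). assert (H2 := HN (S N) ltac:(lia)).
    assert (H3 := Hlip (u N) z (Hur N) Hzr).
    replace (Cminus (T z) z) with (Cminus (Cminus (u (S N)) z) (Cminus (T (u N)) (T z)))
      by (simpl; ring).
    eapply Rle_trans; [apply Cmod_triangle_sub|].
    assert (H4 := Cmod_ge_0 (Cminus (u N) z)). nra. }
  replace (T z) with (Cplus (Cminus (T z) z) z) by ring. rewrite E. ring.
Qed.

Lemma Cmod_sum_minus_le (f g : nat -> C) (b : nat -> R) (m n : nat) :
  (forall k, (m <= k <= n)%nat -> Cmod (Cminus (f k) (g k)) <= b k) ->
  Cmod (Cminus (sum_n_m f m n) (sum_n_m g m n)) <= sum_n_m b m n.
Proof.
  induction n as [|n IH]; intros H.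
  - destruct m as [|m].
    + rewrite !sum_n_n. apply H. lia.
    + rewrite !sum_n_m_zero by lia.
      replace (Cminus zero zero) with (RtoC 0) by (unfold zero; simpl; ring).
      rewrite Cmod_0. unfold zero; simpl; lra.
  - destruct (Compare_dec.le_lt_dec m (S n)) as [Hm|Hm].
    + rewrite !sum_n_Sm by trivial. unfold plus; simpl.
      replace (Cminus (Cplus (sum_n_m f m n) (f (S n))) (Cplus (sum_n_m g m n) (g (S n))))
        with (Cplus (Cminus (sum_n_m f m n) (sum_n_m g m n)) (Cminus (f (S n)) (g (S n)))) by ring.
      eapply Rle_trans; [apply Cmod_triangle|]. apply Rplus_le_compat.
      * apply IH. intros k Hk. apply H. lia.
      * apply H. lia.
    + rewrite !sum_n_m_zero by lia.
      replace (Cminus zero zero) with (RtoC 0) by (unfold zero; simpl; ring).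
      rewrite Cmod_0. unfold zero; simpl; lra.
Qed.

Lemma Cpow_lipschitz (z w : C) (rho : R) (k : nat) : Cmod z <= rho -> Cmod w <= rho ->
  Cmod (Cminus (Cpow z k) (Cpow w k)) <= INR k * rho ^ (k - 1) * Cmod (Cminus z w).
Proof.
  intros Hz Hw. assert (Hz0 := Cmod_ge_0 z).
  assert (Hrho : forall n, 0 <= rho ^ n) by (intros n; apply pow_le; lra).
  assert (Hd := Cmod_ge_0 (Cminus z w)).
  induction k as [|k IH].
  - simpl. replace (Cminus (RtoC 1) (RtoC 1)) with (RtoC 0) by ring. rewrite Cmod_0. lra.
  - rewrite !Cpow_S, S_INR.
    replace (S k - 1)%nat with k by lia.
    replace (Cminus (Cmult z (Cpow z k)) (Cmult w (Cpow w k))) with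
      (Cplus (Cmult z (Cminus (Cpow z k) (Cpow w k))) (Cmult (Cpow w k) (Cminus z w))) by ring.
    eapply Rle_trans; [apply Cmod_triangle|]. rewrite !Cmod_mult, Cmod_pow.
    assert (H1 : Cmod w ^ k <= rho ^ k) by (apply pow_incr; split; [apply Cmod_ge_0 | trivial]).
    assert (H2 : Cmod z * Cmod (Cminus (Cpow z k) (Cpow w k)) <= INR k * rho ^ k * Cmod (Cminus z w)).
    { apply Rle_trans with (rho * (INR k * rho ^ (k - 1) * Cmod (Cminus z w))).
      - apply Rmult_le_compat; trivial. apply Cmod_ge_0.
      (* For k = 0 the truncated exponent [k - 1] is 0, and the factor [INR 0] saves the
         inequality. *)
      - destruct k as [|k]; [simpl; lra|]. replace (S k - 1)%nat with k by lia. simpl pow. right; ring. }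
    assert (H3 := Rmult_le_compat_r _ _ _ Hd H1). lra.
Qed.

Lemma Cmod_Cconj (z : C) : Cmod (Cconj z) = Cmod z.
Proof. unfold Cmod, Cconj; simpl. f_equal. ring. Qed.

(** L(rho) / M, so the equation for rho1 reads [M * lipschitz_bound n rho1 = 1] with n = alpha - 1.
    For n = 0 the sum is empty. *)
Definition lipschitz_bound (n : nat) (rho : R) : R :=
  rho * (2 - rho) / (1 - rho) ^ 2 +
  sum_n_m (fun k : nat => rho ^ k * (1 + INR k - rho) / (1 - rho) ^ 2) 1 n.

Lemma lipschitz_bound_0 (n : nat) : lipschitz_bound n 0 = 0.
Proof.
  unfold lipschitz_bound.
  rewrite (sum_n_m_ext_loc _ (fun _ => zero)).
  - rewrite sum_n_m_const_zero. unfold zero; simpl. field.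
  - intros k Hk. rewrite pow_ne_zero by lia. unfold zero; simpl. field.
Qed.

Lemma lipschitz_bound_S (n : nat) (rho : R) :
  lipschitz_bound (S n) rho =
  lipschitz_bound n rho + rho ^ S n * (1 + INR (S n) - rho) / (1 - rho) ^ 2.
Proof.
  unfold lipschitz_bound. rewrite sum_n_Sm by lia. unfold plus; simpl. ring.
Qed.

Lemma lipschitz_bound_O (rho : R) :
  lipschitz_bound 0 rho = rho * (2 - rho) / (1 - rho) ^ 2.
Proof. unfold lipschitz_bound. rewrite sum_n_m_zero by lia. unfold zero; simpl. ring. Qed.

Lemma lipschitz_bound_continuous (n : nat) (rho : R) : rho < 1 ->
  continuity_pt (lipschitz_bound n) rho.
Proof.
  intros H. induction n as [|n IH].
  - apply (continuity_pt_ext (fun r => r * (2 - r) / (1 - r) ^ 2)).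
    + intros r. now rewrite lipschitz_bound_O.
    + apply ex_derive_continuity_pt. auto_derive.
      assert (0 < (1 - rho) ^ 2) by (apply pow_lt; lra). simpl in *; lra.
  - apply (continuity_pt_ext (fun r => lipschitz_bound n r + r ^ S n * (1 + INR (S n) - r) / (1 - r) ^ 2)).
    + intros r. now rewrite lipschitz_bound_S.
    + apply continuity_pt_plus; trivial.
      apply ex_derive_continuity_pt. auto_derive.
      assert (0 < (1 - rho) ^ 2) by (apply pow_lt; lra). simpl in *; lra.
Qed.

(** In terms of x = 1 / (1 - r), the first term is x^2 - 1 and the term of index k is r^k (k x^2 +
    x). The first is strictly increasing, the others are nondecreasing. *)
Lemma lipschitz_bound_increasing (n : nat) (r s : R) : 0 <= r -> r < s -> s < 1 ->
  lipschitz_bound n r < lipschitz_bound n s.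
Proof.
  intros Hr Hrs Hs.
  assert (Hinv : / (1 - r) < / (1 - s)) by (apply Rinv_lt_contravar; nra).
  assert (Hi0 : 0 < / (1 - r)) by (apply Rinv_0_lt_compat; lra).
  induction n as [|n IH].
  - rewrite !lipschitz_bound_O.
    replace (r * (2 - r) / (1 - r) ^ 2) with (/ (1 - r) * / (1 - r) - 1) by (field; lra).
    replace (s * (2 - s) / (1 - s) ^ 2) with (/ (1 - s) * / (1 - s) - 1) by (field; lra).
    nra.
  - rewrite !lipschitz_bound_S. apply Rplus_lt_le_compat; trivial.
    assert (HI := pos_INR (S n)). set (m := INR (S n)) in *.
    replace (r ^ S n * (1 + m - r) / (1 - r) ^ 2) with
      (r ^ S n * (m * (/ (1 - r) * / (1 - r)) + / (1 - r))) by (field; lra).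
    replace (s ^ S n * (1 + m - s) / (1 - s) ^ 2) with
      (s ^ S n * (m * (/ (1 - s) * / (1 - s)) + / (1 - s))) by (field; lra).
    set (x := / (1 - r)) in *. set (y := / (1 - s)) in *.
    assert (x * x <= y * y) by nra.
    apply Rmult_le_compat.
    + now apply pow_le.
    + assert (0 <= m * (x * x)) by (apply Rmult_le_pos; nra). lra.
    + apply pow_incr. lra.
    + assert (m * (x * x) <= m * (y * y)) by now apply Rmult_le_compat_l. lra.
Qed.

Lemma lipschitz_bound_ge_0 (n : nat) (r : R) : 0 <= r < 1 -> 0 <= lipschitz_bound n r.
Proof.
  intros [[H|<-] H1].
  - rewrite <- (lipschitz_bound_0 n). apply Rlt_le, lipschitz_bound_increasing; lra.
  - rewrite lipschitz_bound_0. lra.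
Qed.

Lemma lipschitz_bound_root (n : nat) (M : R) : 0 < M ->
  exists rho, 0 < rho < 1 /\ M * lipschitz_bound n rho = 1.
Proof.
  intros HM.
  (* At this point the first term alone gives M (1 / (1 - t)^2 - 1) = 2 + 1 / M > 1, which replaces
     a limit at 1 in the intermediate value argument. *)
  set (t := / (1 + M)).
  assert (Ht : 0 < t < 1).
  { unfold t. split; [apply Rinv_0_lt_compat; lra|].
    rewrite <- Rinv_1. apply Rinv_lt_contravar; lra. }
  assert (Hbig : 2 <= M * lipschitz_bound n t).
  { apply Rle_trans with (M * lipschitz_bound 0 t).
    - rewrite lipschitz_bound_O. 
      replace (M * (t * (2 - t) / (1 - t) ^ 2)) with (2 + / M) by (unfold t; field; lra).
      assert (0 < / M) by now apply Rinv_0_lt_compat. lra.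
    - apply Rmult_le_compat_l; [lra|].
      induction n as [|n IH]; [lra|]. rewrite lipschitz_bound_S.
      assert (0 <= t ^ S n * (1 + INR (S n) - t) / (1 - t) ^ 2); [|lra].
      apply Rdiv_le_0_compat; [|apply pow_lt; lra].
      apply Rmult_le_pos; [apply pow_le; lra|]. assert (H := pos_INR (S n)). lra. }
  destruct (IVT_interv (fun r => M * lipschitz_bound n r - 1) 0 t) as [rho [Hrho E]].
  - intros a Ha. apply continuity_pt_minus; [|apply continuity_pt_const; now intros ? ?].
    apply continuity_pt_scal, lipschitz_bound_continuous. lra.
  - lra.
  - rewrite lipschitz_bound_0. lra.
  - lra.
  - exists rho. split; [|lra]. destruct (Req_dec rho 0) as [->|Hne]; [|lra].
    rewrite lipschitz_bound_0 in E. lra.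
Qed.

(* The proof gives the factor [1 + k - k * rho], which is at most [1 + k - rho] as [1 <= k]. *)
Lemma conj_pow_mult_lipschitz (f : C -> C) (M rho : R) (k : nat) (z w : C) :
  normalized_bounded f M -> rho < 1 -> Cmod z <= rho -> Cmod w <= rho -> (1 <= k)%nat -> 0 < M ->
  Cmod (Cminus (Cmult (Cpow (Cconj z) k) (f z)) (Cmult (Cpow (Cconj w) k) (f w))) <=
    M * (rho ^ k * (1 + INR k - rho) / (1 - rho) ^ 2) * Cmod (Cminus z w).
Proof.
  intros Hf Hrho Hz Hw Hk HM.
  assert (Hz0 := Cmod_ge_0 z). assert (Hd := Cmod_ge_0 (Cminus z w)).
  (* In the first summand the growth bound M rho / (1 - rho) of f restores the power of rho lost in
     k rho^(k-1), so both summands carry rho^k. *)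
  replace (Cminus (Cmult (Cpow (Cconj z) k) (f z)) (Cmult (Cpow (Cconj w) k) (f w))) with
    (Cplus (Cmult (Cminus (Cpow (Cconj z) k) (Cpow (Cconj w) k)) (f z))
       (Cmult (Cpow (Cconj w) k) (Cminus (f z) (f w)))) by ring.
  eapply Rle_trans; [apply Cmod_triangle|]. rewrite !Cmod_mult, Cmod_pow, Cmod_Cconj.
  assert (H1 := Cpow_lipschitz (Cconj z) (Cconj w) rho k
     ltac:(now rewrite Cmod_Cconj) ltac:(now rewrite Cmod_Cconj)).
  assert (H2 := normalized_bounded_growth f M rho z Hf Hrho Hz).
  assert (H3 := normalized_bounded_lipschitz f M rho z w Hf Hrho Hz Hw).
  assert (H4 : Cmod w ^ k <= rho ^ k) by (apply pow_incr; split; [apply Cmod_ge_0 | trivial]).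
  assert (P1 := Rmult_le_compat _ _ _ _ (Cmod_ge_0 _) (Cmod_ge_0 _) H1 H2).
  replace (Cmod (Cminus (Cconj z) (Cconj w))) with (Cmod (Cminus z w)) in P1
    by now rewrite <- Cminus_conj, Cmod_Cconj.
  assert (P2 := Rmult_le_compat _ _ _ _ (pow_le _ k (Cmod_ge_0 w)) (Cmod_ge_0 _) H4 H3).
  destruct k as [|k]; [lia|]. replace (S k - 1)%nat with k in P1 by lia.
  eapply Rle_trans; [apply Rplus_le_compat; [exact P1 | exact P2]|].
  set (m := INR (S k)) in *. assert (Hm : 0 <= m) by apply pos_INR.
  set (D := Cmod (Cminus z w)) in *.
  simpl pow.
  replace (m * rho ^ k * D * (M * (rho / (1 - rho))) + rho * rho ^ k * (M * (D / ((1 - rho) * ((1 - rho) * 1)))))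
    with (M * D * (rho * rho ^ k) * / (1 - rho) ^ 2 * (m * (1 - rho) + 1)) by (field; lra).
  replace (M * (rho * rho ^ k * (1 + m - rho) / ((1 - rho) * ((1 - rho) * 1))) * D)
    with (M * D * (rho * rho ^ k) * / (1 - rho) ^ 2 * (1 + m - rho)) by (field; lra).
  apply Rmult_le_compat_l.
  - assert (0 <= / (1 - rho) ^ 2) by (apply Rlt_le, Rinv_0_lt_compat, pow_lt; lra).
    assert (0 <= rho ^ k) by (apply pow_le; lra).
    repeat apply Rmult_le_pos; lra.
  - assert (1 <= m) by (unfold m; rewrite S_INR; assert (H := pos_INR k); lra). nra.
Qed.

Lemma sum_shifted_pow (n : nat) (r : R) : r < 1 ->
  sum_n_m (fun k => r ^ (k + 1)) 1 n = r ^ 2 * ((1 - r ^ n) / (1 - r)).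
Proof.
  intros Hr. induction n as [|n IH].
  - rewrite sum_n_m_zero by lia. unfold zero; simpl. field. lra.
  - rewrite sum_n_Sm, IH by lia. unfold plus; simpl.
    rewrite pow_add. simpl. field. lra.
Qed.

(** The term k = 0 is set apart because it alone approximates the identity. *)
Lemma polyanalytic_split (n : nat) (F : C -> C) (A : nat -> C -> C) (z : C) :
  (forall z : C, disk 1 z -> F z = sum_n_m (fun k : nat => (Cpow (Cconj z) k * A k z)%C) 0 n) ->
  disk 1 z ->
  F z = Cplus (A 0%nat z) (sum_n_m (fun k : nat => (Cpow (Cconj z) k * A k z)%C) 1 n).
Proof.
  intros HF Hz. rewrite HF, sum_Sn_m by (trivial; lia). simpl. unfold plus; simpl.
  f_equal. ring.
Qed.

Lemma polyanalytic_lipschitz_id (n : nat) (M : R) (F : C -> C) (A : nat -> C -> C)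
    (rho : R) (z w : C) :
  0 < M ->
  (forall z : C, disk 1 z -> F z = sum_n_m (fun k : nat => (Cpow (Cconj z) k * A k z)%C) 0 n) ->
  (forall k, (k <= n)%nat -> normalized_bounded (A k) M) ->
  rho < 1 -> Cmod z <= rho -> Cmod w <= rho ->
  Cmod (Cminus (Cminus (F z) z) (Cminus (F w) w)) <= M * lipschitz_bound n rho * Cmod (Cminus z w).
Proof.
  intros HM HF HA Hrho Hz Hw.
  rewrite (polyanalytic_split n F A z HF), (polyanalytic_split n F A w HF) by (unfold disk; lra).
  set (S := fun z => sum_n_m (fun k : nat => (Cpow (Cconj z) k * A k z)%C) 1 n).
  change (sum_n_m (fun k : nat => (Cpow (Cconj z) k * A k z)%C) 1 n) with (S z).
  change (sum_n_m (fun k : nat => (Cpow (Cconj w) k * A k w)%C) 1 n) with (S w).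
  replace (Cminus (Cminus (Cplus (A 0%nat z) (S z)) z) (Cminus (Cplus (A 0%nat w) (S w)) w))
    with (Cplus (Cminus (Cminus (A 0%nat z) (A 0%nat w)) (Cminus z w)) (Cminus (S z) (S w))) by ring.
  eapply Rle_trans; [apply Cmod_triangle|].
  assert (H0 := normalized_bounded_lipschitz_id (A 0%nat) M rho z w (HA 0%nat ltac:(lia)) Hrho Hz Hw).
  assert (HS : Cmod (Cminus (S z) (S w)) <=
    sum_n_m (fun k => mult (M * Cmod (Cminus z w)) (rho ^ k * (1 + INR k - rho) / (1 - rho) ^ 2)) 1 n).
  { apply Cmod_sum_minus_le. intros k Hk.
    eapply Rle_trans; [apply (conj_pow_mult_lipschitz (A k) M rho); trivial; try lia; apply HA; lia|].
    unfold mult; simpl. right; ring. }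
  rewrite (sum_n_m_mult_l (K := R_Ring)) in HS.
  change (Cmod (Cminus (S z) (S w)) <= M * Cmod (Cminus z w) *
    sum_n_m (fun k => rho ^ k * (1 + INR k - rho) / (1 - rho) ^ 2) 1 n) in HS.
  unfold lipschitz_bound. lra.
Qed.

(** The origin of R1. For k >= 1, |A_k(z)| <= rho + M rho^2 / (1 - rho), so the term of index k is
    at most rho^(k+1) + M rho^(k+2) / (1 - rho). The powers rho^(k+1) add up to the geometric
    expression, and the term k = 0 contributes only M rho^2 / (1 - rho). *)
Lemma polyanalytic_near_id (n : nat) (M : R) (F : C -> C) (A : nat -> C -> C)
    (rho : R) (z : C) :
  (forall z : C, disk 1 z -> F z = sum_n_m (fun k : nat => (Cpow (Cconj z) k * A k z)%C) 0 n) ->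
  (forall k, (k <= n)%nat -> normalized_bounded (A k) M) ->
  rho < 1 -> Cmod z <= rho ->
  Cmod (Cminus (F z) z) <= rho ^ 2 * ((1 - rho ^ n) / (1 - rho))
    + M * sum_n_m (fun k => rho ^ (k + 2) / (1 - rho)) 0 n.
Proof.
  intros HF HA Hrho Hz. assert (Hz0 := Cmod_ge_0 z).
  rewrite (polyanalytic_split n F A z HF) by (unfold disk; lra).
  set (S := sum_n_m (fun k : nat => (Cpow (Cconj z) k * A k z)%C) 1 n).
  replace (Cminus (Cplus (A 0%nat z) S) z) with (Cplus (Cminus (A 0%nat z) z) S) by ring.
  eapply Rle_trans; [apply Cmod_triangle|].
  assert (H0 := normalized_bounded_id (A 0%nat) M rho z (HA 0%nat ltac:(lia)) Hrho Hz).
  assert (HS : Cmod S <= sum_n_m (fun k => plus (rho ^ (k + 1)) (mult M (rho ^ (k + 2) / (1 - rho)))) 1 n).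
  (* A sum of zeros is subtracted so that [Cmod_sum_minus_le] applies. *)
  { replace S with (Cminus S (sum_n_m (fun _ => zero) 1 n))
      by (rewrite sum_n_m_const_zero; unfold zero; simpl; ring).
    apply Cmod_sum_minus_le. intros k Hk.
    replace (Cminus _ _) with (Cmult (Cpow (Cconj z) k) (A k z)) by (unfold zero; simpl; ring).
    rewrite Cmod_mult, Cmod_pow, Cmod_Cconj.
    assert (H1 := normalized_bounded_id (A k) M rho z (HA k ltac:(lia)) Hrho Hz).
    assert (H2 := Cmod_sub_ge (A k z) z).
    assert (H3 : Cmod (A k z) <= rho + M * (rho ^ 2 / (1 - rho))) by lra.
    assert (H4 : Cmod z ^ k <= rho ^ k) by now apply pow_incr.
    eapply Rle_trans; [apply Rmult_le_compat; [now apply pow_le | apply Cmod_ge_0 | exact H4 | exact H3]|].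
    unfold plus, mult; simpl. rewrite !pow_add. right. simpl. field. lra. }
  rewrite sum_n_m_plus, (sum_n_m_mult_l (K := R_Ring)), sum_shifted_pow in HS by trivial.
  rewrite (sum_Sn_m (fun k => rho ^ (k + 2) / (1 - rho)) 0 n) by lia.
  change (Cmod S <= rho ^ 2 * ((1 - rho ^ n) / (1 - rho))
    + M * sum_n_m (fun k => rho ^ (k + 2) / (1 - rho)) 1 n) in HS.
  change (plus (rho ^ (0 + 2) / (1 - rho)) (sum_n_m (fun k => rho ^ (k + 2) / (1 - rho)) 1 n))
    with (rho ^ 2 / (1 - rho) + sum_n_m (fun k => rho ^ (k + 2) / (1 - rho)) 1 n).
  lra.
Qed.

Theorem theorem1 (alpha : nat) (M : R) (F : C -> C) (A : nat -> C -> C)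
  (halpha : (1 <= alpha)%nat)
  (hM : 0 < M)
  (hF : polyanalytic_on (disk 1) alpha F)
  (hFA : forall z : C, disk 1 z ->
     F z = sum_n_m (fun k : nat => (Cpow (Cconj z) k * A k z)%C) 0 (alpha - 1))
  (hA : forall k : nat, (k < alpha)%nat -> analytic_on (disk 1) (A k))
  (hA0 : forall k : nat, (k < alpha)%nat -> A k (RtoC 0) = RtoC 0)
  (hA1 : forall k : nat, (k < alpha)%nat ->
     is_derive (K := C_AbsRing) (V := C_NormedModule) (A k) (RtoC 0) (RtoC 1))
  (hAM : forall (k : nat) (z : C), (k < alpha)%nat -> disk 1 z ->
     Cmod (A k z) <= M) :
  exists rho1 : R,
    0 < rho1 < 1 /\
    1 - M * (rho1 * (2 - rho1) / (1 - rho1) ^ 2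
             + sum_n_m (fun k : nat =>
                 rho1 ^ k * (1 + INR k - rho1) / (1 - rho1) ^ 2) 1 (alpha - 1))
      = 0 /\
    univalent_on (disk rho1) F /\
    (let R1 := rho1 - rho1 ^ 2 * ((1 - rho1 ^ (alpha - 1)) / (1 - rho1))
               - M * sum_n_m (fun k : nat => rho1 ^ (k + 2) / (1 - rho1))
                       0 (alpha - 1) in
     forall w : C, disk R1 w -> exists z : C, disk rho1 z /\ F z = w).
Proof.
  set (n := (alpha - 1)%nat) in *.
  assert (HA : forall k, (k <= n)%nat -> normalized_bounded (A k) M).
  { intros k Hk. assert (Hk' : (k < alpha)%nat) by (unfold n in Hk; lia).
    exact (conj (hA k Hk') (conj (hA0 k Hk') (conj (hA1 k Hk') (fun z => hAM k z Hk')))). }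
  destruct (lipschitz_bound_root n M hM) as [rho1 [Hrho Hroot]].
  exists rho1. split; trivial. split.
  { unfold lipschitz_bound in Hroot. lra. }
  assert (Hlip := fun r z w => polyanalytic_lipschitz_id n M F A r z w hM hFA HA).
  assert (Hcontr : forall r, 0 <= r < rho1 -> 0 <= M * lipschitz_bound n r < 1).
  { intros r Hr. split.
    - apply Rmult_le_pos; [lra | apply lipschitz_bound_ge_0; lra].
    - rewrite <- Hroot. apply Rmult_lt_compat_l; trivial. apply lipschitz_bound_increasing; lra. }
  split.
  - intros z w Hz Hw E. unfold disk in Hz, Hw.
    destruct (Ceq_dec z w) as [|Hne]; trivial. exfalso.
    (* At rho1 itself the Lipschitz constant is exactly 1; on the smaller closed disk through the
       outer point it is strictly less. *)
    set (r := Rmax (Cmod z) (Cmod w)).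
    assert (Hzr : Cmod z <= r) by apply Rmax_l. assert (Hwr : Cmod w <= r) by apply Rmax_r.
    assert (Hr : r < rho1) by now apply Rmax_lub_lt.
    assert (Hz0 := Cmod_ge_0 z).
    specialize (Hlip r z w ltac:(lra) Hzr Hwr).
    rewrite E in Hlip.
    replace (Cminus (Cminus (F w) z) (Cminus (F w) w)) with (Cminus w z) in Hlip by ring.
    rewrite Cmod_minus_sym in Hlip.
    assert (Hpos := proj1 (Cmod_gt_0 _) (Cminus_neq_0 _ _ Hne)).
    destruct (Hcontr r ltac:(lra)). nra.
  - intros R1 w Hw. unfold disk in Hw.
    assert (Hnear := fun z => polyanalytic_near_id n M F A rho1 z hFA HA ltac:(lra)).
    set (B := rho1 ^ 2 * ((1 - rho1 ^ n) / (1 - rho1))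
       + M * sum_n_m (fun k => rho1 ^ (k + 2) / (1 - rho1)) 0 n) in *.
    assert (HB : R1 = rho1 - B) by (unfold R1, B; ring).
    assert (HB0 : 0 <= B).
    { eapply Rle_trans; [apply Cmod_ge_0 | apply (Hnear (RtoC 0))]. rewrite Cmod_0. lra. }
    assert (Hw0 := Cmod_ge_0 w).
    (* Two radii are in play: [B] bounds F(z) - z on the whole disk of radius rho1, while the
       Lipschitz constant is taken at |w| + B < rho1, where it is below 1. *)
    destruct (disk_contraction_fixed_point (fun z => Cminus w (Cminus (F z) z)) (Cmod w + B)
      (M * lipschitz_bound n (Cmod w + B))) as [z [Hz E]].
    + lra.
    + apply Hcontr. lra.
    + intros z Hz. eapply Rle_trans; [apply Cmod_triangle_sub|].
      apply Rplus_le_compat_l, Hnear. lra.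
    + intros z z' Hz Hz'.
      replace (Cminus (Cminus w (Cminus (F z) z)) (Cminus w (Cminus (F z') z')))
        with (Cminus (Cminus (F z') z') (Cminus (F z) z)) by ring.
      rewrite Cmod_minus_sym. apply Hlip; lra.
    + exists z. split; [unfold disk; lra|].
      replace (F z) with (Cminus (Cplus w z) (Cminus w (Cminus (F z) z))) by ring.
      rewrite E. ring.
Qed.
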